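(* Assume that the homogeneous part $\dot x=A(u(t))x$ satisfies the accessibility rank condition on $\mathbb R^n\setminus\{0\}$, that there is a $\sigma$-periodic $u\in\mathcal U_{pc}$ ($\sigma>0$) with $g(u)\in\mathcal S_\sigma\cap\mathrm{int}(\mathcal S)$ and $1\notin\mathrm{spec}(\Phi_u(\sigma,0))$, and that the affine system has at most finitely many control sets with nonvoid interior. Then for every control set ${}_{\mathbb R}D_i^{\hom}\subset\mathbb R^n\setminus\{0\}$ with nonvoid interior of the homogeneous part there is a control set $D\subset\mathbb R^n$ with nonvoid interior of the affine system such that $\partial_\infty(D)\cap e({}_{\mathbb P}D_i^{\hom})\neq\varnothing$, where ${}_{\mathbb P}D_i^{\hom}$ is the control set in $\mathbb P^{n-1}$ containing $\pi_{\mathbb P}({}_{\mathbb R}D_i^{\hom})$.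
   Context: Affine system $\dot x=A(u(t))x+Cu(t)+d$, $u(t)\in\Omega$, $A(u)=A+\sum_iu_iB_i$, $C=(c_1,\dots,c_m)$, $\Omega\subset\mathbb R^m$ bounded with $0\in\Omega$, satisfying the accessibility rank condition on $\mathbb R^n$; $\mathcal U_{pc}$ piecewise constant $\Omega$-valued controls; homogeneous part $\dot x=A(u(t))x$ with solutions $\varphi_{\hom}$ and principal fundamental solution $\Phi_u(t,s)$; it induces systems on $\mathbb R^n\setminus\{0\}$ and on $\mathbb P^{n-1}$ (trajectories $\pi_{\mathbb P}\varphi_{\hom}(t,x,u)$). $\mathcal S$: system semigroup in $\mathbb R^n\ltimes GL(n,\mathbb R)$ generated by time-$t$ maps ($t>0$) of $x\mapsto A(w)x+Cw+d$, $w\in\Omega$; $\mathcal S_\sigma$: elements of total time $\sigma$; interior in the generated group (Lie group topology); $g(u)\in\mathcal S_\sigma$ the element corresponding to $u$ on $[0,\sigma]$, so $g(u)x=\varphi(\sigma,x,u)$. Control set (on any state space): nonvoid maximal $D$ such that each $x\in D$ admits a control keeping the trajectory in $D$ for $t\ge0$ and $D\subset\overline{\mathcal O^+(x)}$ for all $x\in D$. Projective setting: bilinear system on $\mathbb R^{n+1}$, $\frac d{dt}(x,z)=\big(\begin{pmatrix}A&d\\0&0\end{pmatrix}+\sum_iu_i\begin{pmatrix}B_i&c_i\\0&0\end{pmatrix}\big)(x,z)$, projected to $\mathbb P^n$; $\mathbb P^{n,0}=\{[x_1:\cdots:x_n:0]\}$; $e([x_1:\cdots:x_n])=[x_1:\cdots:x_n:0]$;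 for a control set $D\subset\mathbb R^n$, $\partial_\infty(D):=\partial(\{[x_1:\cdots:x_n:1]:x\in D\})\cap\mathbb P^{n,0}$. *)

(* Defs.v *)
From HB Require Import structures.
From mathcomp Require Import all_boot all_order all_algebra.
From mathcomp Require Import all_classical all_reals all_analysis.
Set Implicit Arguments. Unset Strict Implicit. Unset Printing Implicit Defensive.
Import Order.TTheory GRing.Theory Num.Theory.
Import numFieldNormedType.Exports.
Local Open Scope ring_scope.
Local Open Scope classical_set_scope.

Section Defs.
Variable R : realType.

(* sup-norm of a matrix (all norms on R^k are equivalent) *)
Definition mxnorm p q (M : 'M[R]_(p, q)) : R :=
  \big[Num.max/0]_(i < p) \big[Num.max/0]_(j < q) `|M i j|.

Definition expm k (M : 'M[R]_k) : 'M[R]_k :=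
  \matrix_(i, j) limn (fun N : nat => \sum_(l < N) (l`!%:R)^-1 * (M ^+ l) i j).

Inductive liealg k (G : set 'M[R]_k) : 'M[R]_k -> Prop :=
| la_gen Z : G Z -> liealg G Z
| la_zero : liealg G 0
| la_add Z1 Z2 : liealg G Z1 -> liealg G Z2 -> liealg G (Z1 + Z2)
| la_scale (c : R) Z : liealg G Z -> liealg G (c *: Z)
| la_br Z1 Z2 : liealg G Z1 -> liealg G Z2 -> liealg G (Z1 *m Z2 - Z2 *m Z1).

Definition closureR k (A : set 'cV[R]_k) : set 'cV[R]_k :=
  [set y | forall e : R, 0 < e -> exists2 a, A a & mxnorm (y - a) < e].
Definition has_interior k (A : set 'cV[R]_k) : Prop :=
  exists x, exists2 e : R, 0 < e & forall y, mxnorm (y - x) < e -> A y.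

(* ---- projective space P^{k-1}: points [x] represented by nonzero x in R^k,
   subsets by scale-invariant sets of nonzero vectors (cones); topology is the
   quotient topology, with basic neighbourhoods {[z] | exists c, |y - c z| < e} ---- *)
Definition cone k (A : set 'cV[R]_k) : Prop :=
  (forall x, A x -> x != 0) /\ (forall x (c : R), A x -> c != 0 -> A (c *: x)).
Definition nbhsP k (y : 'cV[R]_k) (e : R) : set 'cV[R]_k :=
  [set z | z != 0 /\ exists2 c : R, c != 0 & mxnorm (y - c *: z) < e].
Definition closureP k (A : set 'cV[R]_k) : set 'cV[R]_k :=
  [set y | y != 0 /\ forall e : R, 0 < e -> exists z, A z /\ nbhsP y e z].
Definition interiorP k (A : set 'cV[R]_k) : set 'cV[R]_k :=
  [set y | y != 0 /\ exists2 e : R, 0 < e & nbhsP y e `<=` A].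
Definition boundaryP k (A : set 'cV[R]_k) : set 'cV[R]_k :=
  closureP A `&` ~` interiorP A.

(* ---- control systems given by flows for constant controls ---- *)
Variables (m k : nat).
Implicit Types (F : 'cV[R]_m -> R -> 'cV[R]_k -> 'cV[R]_k) (Om : set 'cV[R]_m).

(* state after applying a finite sequence of constant pieces (value, duration) *)
Definition run F (s : seq ('cV[R]_m * R)) (x : 'cV[R]_k) : 'cV[R]_k :=
  foldl (fun y p => F p.1 p.2 y) x s.

Definition orbit_pos F Om (x : 'cV[R]_k) : set 'cV[R]_k :=
  [set y | exists s : seq ('cV[R]_m * R),
     (forall p, p \in s -> Om p.1 /\ 0 <= p.2) /\ y = run F s x].

Fixpoint stateN F (w : nat -> 'cV[R]_m) (tau : nat -> R) (x : 'cV[R]_k) (j : nat)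
  : 'cV[R]_k :=
  if j is j'.+1 then F (w j') (tau j') (stateN F w tau x j') else x.

(* an Om-valued piecewise constant control on [0, oo) (pieces (w j, tau j),
   tau j > 0, no accumulation of switching times) keeps the trajectory from x in D *)
Definition can_stay F Om (D : set 'cV[R]_k) (x : 'cV[R]_k) : Prop :=
  exists (w : nat -> 'cV[R]_m) (tau : nat -> R),
    [/\ forall j, Om (w j), forall j, 0 < tau j,
        forall T : R, exists N, T <= \sum_(j < N) tau j &
        forall j (s : R), 0 <= s <= tau j -> D (F (w j) s (stateN F w tau x j))].

Definition ctrl_pre F Om (X D : set 'cV[R]_k) : Prop :=
  [/\ D `<=` X, D !=set0,
      forall x, D x -> can_stay F Om D x &
      forall x, D x -> D `<=` closureR (orbit_pos F Om x)].
Definition control_set F Om (X D : set 'cV[R]_k) : Prop :=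
  ctrl_pre F Om X D /\
  (forall D', ctrl_pre F Om X D' -> D `<=` D' -> D' = D).

(* control set of the induced system on P^{k-1} (for a linear system F);
   sets of P^{k-1} are represented by cones *)
Definition ctrl_preP F Om (D : set 'cV[R]_k) : Prop :=
  [/\ cone D, D !=set0,
      forall x, D x -> can_stay F Om D x &
      forall x, D x -> D `<=` closureP (orbit_pos F Om x)].
Definition control_setP F Om (D : set 'cV[R]_k) : Prop :=
  ctrl_preP F Om D /\
  (forall D', ctrl_preP F Om D' -> D `<=` D' -> D' = D).

End Defs.

Section Affine.
Variables (R : realType) (n m : nat).
Variables (A : 'M[R]_n) (B : 'I_m -> 'M[R]_n) (C : 'M[R]_(n, m)) (d : 'cV[R]_n).

Definition Au (w : 'cV[R]_m) : 'M[R]_n := A + \sum_(i < m) w i 0 *: B i.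
(* the affine vector field x |-> A(w) x + C w + d in homogeneous coordinates;
   this also identifies R^n x| GL(n,R) with a subgroup of GL(n+1,R) *)
Definition Mhat (w : 'cV[R]_m) : 'M[R]_(n + 1) :=
  block_mx (Au w) (C *m w + d) 0 0.

Definition Faff (w : 'cV[R]_m) (t : R) (x : 'cV[R]_n) : 'cV[R]_n :=
  usubmx (expm (t *: Mhat w) *m col_mx x 1).
Definition Fhom (w : 'cV[R]_m) (t : R) (x : 'cV[R]_n) : 'cV[R]_n :=
  expm (t *: Au w) *m x.

Definition ARC_aff (Om : set 'cV[R]_m) : Prop :=
  forall x y : 'cV[R]_n, exists2 Z, liealg [set Mhat w | w in Om] Z &
    usubmx (Z *m col_mx x 1) = y.
Definition ARC_hom (Om : set 'cV[R]_m) : Prop :=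
  forall x : 'cV[R]_n, x != 0 -> forall y : 'cV[R]_n,
    exists2 Z, liealg [set Au w | w in Om] Z & Z *m x = y.

Definition gel (s : seq ('cV[R]_m * R)) : 'M[R]_(n + 1) :=
  foldl (fun g p => expm (p.2 *: Mhat p.1) *m g) 1%:M s.
Definition Phi (s : seq ('cV[R]_m * R)) : 'M[R]_n :=
  foldl (fun g p => expm (p.2 *: Au p.1) *m g) 1%:M s.
Definition total_time (s : seq ('cV[R]_m * R)) : R := \sum_(p <- s) p.2.
Definition admissible (Om : set 'cV[R]_m) (s : seq ('cV[R]_m * R)) : Prop :=
  forall p, p \in s -> Om p.1 /\ 0 < p.2.

Definition semigroupS (Om : set 'cV[R]_m) : set 'M[R]_(n + 1) :=
  [set g | exists2 s, (s != [::]) /\ admissible Om s & g = gel s].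
(* interior of S in the system group G, with its Lie group topology: G is the
   connected Lie subgroup with Lie algebra L generated by the Mhat w, and
   the sets g exp(Z), Z in L small, form a neighbourhood base of g in G *)
Definition in_int_S (Om : set 'cV[R]_m) (g : 'M[R]_(n + 1)) : Prop :=
  exists2 e : R, 0 < e & forall Z, liealg [set Mhat w | w in Om] Z ->
    mxnorm Z < e -> semigroupS Om (g *m expm Z).

Definition embedP (D : set 'cV[R]_n) : set 'cV[R]_(n + 1) :=
  [set v | exists y, D y /\ exists2 c : R, c != 0 & v = c *: col_mx y 1].

End Affine.

(* Main.v *)
Require Import Defs.
From HB Require Import structures.
From mathcomp Require Import all_boot all_order all_algebra.
From mathcomp Require Import all_classical all_reals all_analysis.
From mathcomp Require Import ring lra.
Set Implicit Arguments. Unset Strict Implicit. Unset Printing Implicit Defensive.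
Import Order.TTheory GRing.Theory Num.Theory.
Import numFieldNormedType.Exports.
Local Open Scope ring_scope.
Local Open Scope classical_set_scope.

(* Short words of constant controls exist whose partial derivatives in the
   durations span the system Lie algebra; moving through such a word makes the
   reachability relation open in both endpoints, so a fixed point of a word
   containing one lies in the interior of a control set.  Starting from a point
   x0 in the interior of the homogeneous control set, close such a word up to a
   loop with Phi x0 = x0.  If the affine map of the loop has a fixed point y, all
   points y + c x0 are fixed, hence lie in one control set, which goes to infinity
   in direction x0.  Otherwise deform the loop analytically towards the given word
   with 1 not in the spectrum: arbitrarily small deformations have a unique affine
   fixed point, these lie in finitely many control sets, and in P^n they cluster at
   a fixed point of the loop, necessarily at infinity, i.e. at some [v : 0] with
   Phi v = v.  Fixed vectors of Phi on a line avoiding 0 are mutually reachable, so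
   v belongs to the projective control set. *)

(** * The entrywise sum norm of matrices *)

Section EntrywiseNorm.
Context {R : realType}.
Implicit Types p q r : nat.

(** The loop matrix fixes [x0], so it has eigenvalue 1 and the affine map of the loop may have no
    fixed point; hence the two cases. Two words are planted in the loop because two Lie algebras are
    involved: [sa] is full for the matrices [Mhat w] and puts affine fixed points into the interior
    of control sets, while [sh] is full for the matrices [Au w] and makes points near a homogeneous
    fixed vector mutually reachable. The deformation never touches [sa], so every affine fixed point
    met along it keeps this property; and [sa] is so short that the factor [Phi sa] preserves the
    invertibility available at the far end. Being in the boundary costs nothing beyond
    approximation, since a point at infinity never belongs to [embedP D]. Each perturbed fixed point
    comes with a control set of its own; finiteness makes one [D] occur along the whole cluster. *)

Definition n1 p q (M : 'M[R]_(p, q)) : R := \sum_i \sum_j `|M i j|.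

Lemma n1_ge0 p q (M : 'M[R]_(p, q)) : 0 <= n1 M.
Proof. by apply: sumr_ge0 => i _; apply: sumr_ge0 => j _. Qed.

Lemma n1_0 p q : n1 (0 : 'M[R]_(p, q)) = 0.
Proof. by apply: big1 => i _; apply: big1 => j _; rewrite mxE normr0. Qed.

Lemma n1N p q (M : 'M[R]_(p, q)) : n1 (- M) = n1 M.
Proof. by apply: eq_bigr => i _; apply: eq_bigr => j _; rewrite mxE normrN. Qed.

Lemma n1D p q (M N : 'M[R]_(p, q)) : n1 (M + N) <= n1 M + n1 N.
Proof.
rewrite /n1 -big_split; apply: ler_sum => i _; rewrite -big_split.
by apply: ler_sum => j _; rewrite mxE ler_normD.
Qed.

Lemma n1B p q (M N : 'M[R]_(p, q)) : n1 (M - N) <= n1 M + n1 N.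
Proof. by rewrite -(n1N N) n1D. Qed.

Lemma n1_distC p q (M N : 'M[R]_(p, q)) : n1 (M - N) = n1 (N - M).
Proof. by rewrite -n1N opprB. Qed.

Lemma n1_dist_trans p q (N M L : 'M[R]_(p, q)) :
  n1 (M - L) <= n1 (M - N) + n1 (N - L).
Proof. by rewrite -{1}(subrK N M) -addrA n1D. Qed.

Lemma n1Z p q c (M : 'M[R]_(p, q)) : n1 (c *: M) = `|c| * n1 M.
Proof.
rewrite /n1 mulr_sumr; apply: eq_bigr => i _; rewrite mulr_sumr.
by apply: eq_bigr => j _; rewrite mxE normrM.
Qed.

(** Submultiplicativity without a dimension factor is the reason for working with [n1] in place of
    [mxnorm]. *)
Lemma n1M p q r (M : 'M[R]_(p, q)) (N : 'M[R]_(q, r)) :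
  n1 (M *m N) <= n1 M * n1 N.
Proof.
rewrite /n1 mulr_suml; apply: ler_sum => i _.
under eq_bigr do rewrite mxE.
apply: (@le_trans _ _ (\sum_j \sum_l `|M i l| * `|N l j|)).
  apply: ler_sum => j _; apply: (le_trans (ler_norm_sum _ _ _)).
  by apply: ler_sum => l _; rewrite normrM.
rewrite exchange_big mulr_suml; apply: ler_sum => l _ /=.
rewrite -mulr_sumr; apply: ler_wpM2l => //.
by rewrite [leRHS](bigD1 l) //= lerDl; apply: sumr_ge0 => ? _; apply: sumr_ge0.
Qed.

Lemma le_n1 p q (M : 'M[R]_(p, q)) i j : `|M i j| <= n1 M.
Proof.
rewrite /n1 (bigD1 i) //= (bigD1 j) //= -addrA lerDl.
by apply: addr_ge0; apply: sumr_ge0 => // ? _; apply: sumr_ge0.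
Qed.

Lemma n1_le0 p q (M : 'M[R]_(p, q)) : n1 M <= 0 -> M = 0.
Proof.
move=> h; apply/matrixP => i j; rewrite mxE; apply/normr0_eq0/eqP.
by rewrite eq_le normr_ge0 (le_trans (le_n1 M i j) h).
Qed.

Lemma n1_lt_eq0 p q (M : 'M[R]_(p, q)) :
  (forall e, 0 < e -> n1 M <= e) -> M = 0.
Proof. by move=> h; apply/n1_le0/ler_addgt0Pl => e e0; rewrite addr0 h. Qed.

(** The successor in the denominator admits empty matrices and supplies the strict inequality. *)
Lemma n1_sum_lt p q (M : 'M[R]_(p, q)) (e : R) : 0 < e ->
  (forall i j, `|M i j| < e / (p * q).+1%:R) -> n1 M < e.
Proof.
move=> e0 h.
have c0 : 0 < (p * q).+1%:R :> R by [].
apply: (@le_lt_trans _ _ (\sum_(i < p) \sum_(j < q) e / (p * q).+1%:R)).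
  by apply: ler_sum => i _; apply: ler_sum => j _; apply/ltW.
rewrite !big_const_ord !iter_addr_0 -mulrnA -mulrnAr -[X in _ * X]mulr_natl.
rewrite -[ltRHS]mulr1 ltr_pM2l // ltr_pdivrMr // mul1r ltr_nat.
by rewrite ltnS mulnC.
Qed.

Lemma mxnorm_le_n1 p q (M : 'M[R]_(p, q)) : mxnorm M <= n1 M.
Proof.
rewrite /mxnorm; elim/big_ind: _ => [|x y hx hy|i _]; first exact: n1_ge0.
  by rewrite ge_max hx.
elim/big_ind: _ => [|x y hx hy|j _]; [exact: n1_ge0|by rewrite ge_max hx|].
exact: le_n1.
Qed.

Lemma entry_le_mxnorm p q (M : 'M[R]_(p, q)) i j : `|M i j| <= mxnorm M.
Proof.
rewrite /mxnorm (bigD1 i) //= le_max; apply/orP; left.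
by rewrite (bigD1 j) //= le_max lexx.
Qed.

Lemma n1_le_mxnorm p q (M : 'M[R]_(p, q)) (e : R) : 0 < e ->
  mxnorm M < e / (p * q).+1%:R -> n1 M < e.
Proof.
by move=> e0 h; apply: n1_sum_lt => // i j; apply: le_lt_trans h; apply: entry_le_mxnorm.
Qed.

(** A row [v] of the left kernel satisfies [v = v *m X], hence has norm at most [n1 v * n1 X], which
    forces [v = 0]. This stands in for the Neumann series. *)
Lemma n1_lt1_unit p (X : 'M[R]_p) : n1 X < 1 -> (1%:M - X) \in unitmx.
Proof.
move=> X1; rewrite -row_free_unit -kermx_eq0; apply/eqP/row_matrixP => i.
rewrite row0; set v := row i _.
have vE : v = v *m X.
  have : v *m (1%:M - X) = 0.
    by rewrite /v -row_mul mulmx_ker row0.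
  by rewrite mulmxBr mulmx1 => /eqP; rewrite subr_eq0 => /eqP.
apply: n1_le0; have := n1M v X; rewrite -vE => h.
have v0 := n1_ge0 v; rewrite leNgt; apply/negP => vp.
by have := ltr_pM2l vp (n1 X) 1; rewrite X1 mulr1 ltNge h.
Qed.

End EntrywiseNorm.

(** * The exponential series and its remainder estimates *)

Section Expm.
Context {R : realType}.
Variable k : nat.
Implicit Types M X : 'M[R]_k.

(** The exponent 0 is excluded because [n1 1%:M] is the dimension, not 1. *)
Lemma n1_expr_le M l : (0 < l)%N -> n1 (M ^+ l) <= n1 M ^+ l.
Proof.
case: l => // l _; elim: l => [|l IH] //.
rewrite exprS [leRHS]exprS; apply: le_trans (n1M _ _) _.
by apply: ler_wpM2l (n1_ge0 _) _ _ IH.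
Qed.

Lemma expr_entry_le M l i j : `|(M ^+ l) i j| <= n1 M ^+ l.
Proof.
case: l => [|l]; first by rewrite expr0 mxE; case: eqP; rewrite ?normr1 ?normr0.
exact: le_trans (le_n1 _ _ _) (n1_expr_le _ _).
Qed.

Definition expm_psum M (N : nat) : 'M[R]_k := \sum_(l < N) (l`!%:R)^-1 *: M ^+ l.

Lemma expm_psumE M N i j :
  expm_psum M N i j = \sum_(l < N) (l`!%:R)^-1 * (M ^+ l) i j.
Proof. by rewrite /expm_psum summxE; apply: eq_bigr => l _; rewrite mxE. Qed.

(** Domination by [C] times an exponential series. The factor [C] lets the same bound serve the
    entries of [expm] and their two termwise derivatives. *)
Lemma cvg_pseries_fact (c : nat -> R) (C b x : R) : 0 <= C -> 0 <= b ->
  (forall l, `|c l| <= C * (b ^+ l / l`!%:R)) -> cvgn (pseries c x).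
Proof.
move=> C0 b0 h; apply: normed_cvg.
apply: (@series_le_cvg _ _ (C *: exp_coeff (b * `|x|))).
- by move=> l; apply: normr_ge0.
- by move=> l; rewrite mulr_ge0 // exp_coeff_ge0 // mulr_ge0.
- move=> l; rewrite /= normrM normrX.
  apply: le_trans (ler_wpM2r _ (h l)) _; first exact: exprn_ge0.
  rewrite (_ : (C *: _) l = C * ((b * `|x|) ^+ l / l`!%:R)) // exprMn.
  by rewrite -mulrA ler_wpM2l // mulrAC.
- by apply: is_cvg_seriesZ; apply: is_cvg_series_exp_coeff.
Qed.

Lemma expm_psum_cvg M i j :
  (fun N => expm_psum M N i j) @ \oo --> expm M i j.
Proof.
rewrite /expm mxE.
have -> : (fun N => expm_psum M N i j) =
    (fun N : nat => \sum_(l < N) (l`!%:R)^-1 * (M ^+ l) i j).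
  by apply/funext => N; rewrite expm_psumE.
have -> : (fun N : nat => \sum_(l < N) (l`!%:R)^-1 * (M ^+ l) i j) =
    pseries (fun l => (l`!%:R)^-1 * (M ^+ l) i j) 1.
  apply/funext => N; rewrite /pseries /series /= big_mkord.
  by apply: eq_bigr => l _; rewrite expr1n mulr1.
apply: (@cvg_pseries_fact _ 1 (n1 M)) => // [|l]; first exact: n1_ge0.
rewrite normrM mul1r mulrC [X in _ * X]ger0_norm ?invr_ge0 //.
by apply: ler_wpM2r; [rewrite invr_ge0|apply: expr_entry_le].
Qed.

Lemma expm_psum_lim M (e : R) : 0 < e ->
  exists N0 : nat, forall N, (N0 <= N)%N -> n1 (expm_psum M N - expm M) < e.
Proof.
move=> e0; have e'0 : 0 < e / (k * k).+1%:R by rewrite divr_gt0.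
have H : \forall N \near \oo, forall ij : 'I_k * 'I_k,
    `|expm_psum M N ij.1 ij.2 - expm M ij.1 ij.2| < e / (k * k).+1%:R.
  apply: filter_forall => -[i j].
  by have /cvgr_distC_lt /(_ _ e'0) := @expm_psum_cvg M i j.
case: H => N0 _ H; exists N0 => N hN; apply: n1_sum_lt => // i j.
by have := H N hN (i, j); rewrite !mxE.
Qed.

Lemma n1_expm_le M X (C : R) :
  (forall N : nat, (2 <= N)%N -> n1 (expm_psum M N - X) <= C) -> n1 (expm M - X) <= C.
Proof.
move=> h; apply/ler_addgt0Pr => e e0; have [N0 H] := expm_psum_lim M e0.
apply: le_trans (n1_dist_trans (expm_psum M (maxn 2 N0)) _ _) _.
rewrite addrC lerD //; first by apply: h; rewrite leq_maxl.
by rewrite n1_distC; apply/ltW/H; rewrite leq_maxr.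
Qed.

Lemma expm_psum_commute M N : expm_psum M N *m M = M *m expm_psum M N.
Proof.
rewrite /expm_psum mulmx_suml mulmx_sumr; apply: eq_bigr => l _.
by rewrite -scalemxAl -scalemxAr; congr (_ *: _); rewrite -[LHS]exprSr -[RHS]exprS.
Qed.

Lemma expm_commute M : expm M *m M = M *m expm M.
Proof.
apply/subr0_eq/n1_lt_eq0 => e e0.
have e'0 : 0 < e / (2 * (n1 M + 1)) by rewrite divr_gt0 // mulr_gt0 // ltr_wpDl // n1_ge0.
have [N H] := expm_psum_lim M e'0; have {}H := ltW (H N (leqnn _)).
rewrite (_ : _ - _ = M *m (expm_psum M N - expm M) - (expm_psum M N - expm M) *m M); last first.
  by rewrite mulmxBr mulmxBl expm_psum_commute opprB [RHS]addrC addrA subrK.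
apply: le_trans (n1B _ _) _; apply: le_trans (lerD (n1M _ _) (n1M _ _)) _.
have M0 := n1_ge0 M.
rewrite [X in _ + X]mulrC -mulr2n -[leLHS]mulr_natl.
apply: le_trans (_ : 2 * ((n1 M + 1) * (e / (2 * (n1 M + 1)))) <= _).
  by rewrite ler_pM2l // ler_pM ?n1_ge0 // lerDl.
have M1 : n1 M + 1 != 0 by rewrite gt_eqF // ltr_wpDl.
by rewrite le_eqVlt; apply/orP; left; apply/eqP; field.
Qed.

Lemma geom_bound (a : R) N n0 : 0 <= a -> a <= 1 / 2 ->
  \sum_(n0 <= l < N) a ^+ l <= 2 * a ^+ n0.
Proof.
move=> a0 a1; case: (leqP n0 N) => [nN|Nn]; last first.
  by rewrite big_geq ?(ltnW Nn) // mulr_ge0 // exprn_ge0.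
rewrite -(subnKC nN); elim: (N - n0)%N {nN} => [|m IH].
  by rewrite addn0 big_geq // mulr_ge0 // exprn_ge0.
(* The subtracted term makes the induction close: its step is [2 * a <= 1] multiplied by a power of
   [a]. *)
have : forall j, \sum_(n0 <= l < n0 + j) a ^+ l <= 2 * a ^+ n0 - 2 * a ^+ (n0 + j).
  elim=> [|j IHj]; first by rewrite addn0 big_geq // subrr.
  rewrite addnS big_nat_recr ?leq_addr //= exprSr.
  have := exprn_ge0 (n0 + j) a0; nra.
move=> /(_ m.+1) h; apply: le_trans h _.
by rewrite gerDl oppr_le0 mulr_ge0 // exprn_ge0.
Qed.

Lemma n1_psum_tail M N n0 : (0 < n0 <= N)%N -> n1 M <= 1 / 2 ->
  n1 (expm_psum M N - expm_psum M n0) <= 2 * n1 M ^+ n0.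
Proof.
move=> /andP[n00 nN] M1.
apply: le_trans (geom_bound N n0 (n1_ge0 M) M1).
have -> : expm_psum M N - expm_psum M n0 = \sum_(n0 <= l < N) (l`!%:R)^-1 *: M ^+ l.
  rewrite /expm_psum -!(big_mkord predT (fun l => (l`!%:R)^-1 *: M ^+ l)).
  by rewrite (big_cat_nat (n := n0)) //= addrAC subrr add0r.
rewrite big_seq_cond [leRHS]big_seq_cond.
elim/big_ind2 : _ => [|A a B b hA hB|l]; first by rewrite n1_0.
  by apply: le_trans (n1D _ _) _; rewrite lerD.
rewrite andbT mem_index_iota => /andP[hl _].
rewrite n1Z ger0_norm ?invr_ge0 //.
rewrite -[leRHS]mul1r ler_pM ?invr_ge0 ?n1_ge0 //.
  by rewrite invf_le1 ?ler1n ?ltr0n ?fact_gt0.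
by apply: n1_expr_le; apply: leq_trans hl.
Qed.

Lemma n1_expm1 M : n1 M <= 1 / 2 -> n1 (expm M - 1%:M) <= 2 * n1 M.
Proof.
move=> M1; apply: n1_expm_le => N N2.
have -> : 1%:M = expm_psum M 1 :> 'M[R]_k.
  by rewrite /expm_psum big_ord1 expr0 fact0 invr1 scale1r.
by apply: (@n1_psum_tail M N 1); rewrite // (ltnW N2).
Qed.

Lemma n1_expm2 M : n1 M <= 1 / 2 -> n1 (expm M - (1%:M + M)) <= 2 * n1 M ^+ 2.
Proof.
move=> M1; apply: n1_expm_le => N N2.
have -> : 1%:M + M = expm_psum M 2 :> 'M[R]_k.
  by rewrite /expm_psum big_ord_recr big_ord1 /= expr0 fact0 invr1 !scale1r expr1.
exact: n1_psum_tail.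
Qed.

Lemma expm0 : expm (0 : 'M[R]_k) = 1%:M.
Proof.
apply/subr0_eq/n1_le0; have := @n1_expm1 0; rewrite n1_0 mulr0; apply.
lra.
Qed.

End Expm.

(** * The derivative of the exponential and linear flows *)

Section ExpmDerivative.
Context {R : realType}.

Definition mxderiv p q (F : R -> 'M[R]_(p, q)) (t : R) (F' : 'M[R]_(p, q)) :=
  forall i j, is_derive t 1 (fun u => F u i j) (F' i j).

Lemma is_derive_sum_fun n (f : 'I_n -> R -> R) (t : R) (f' : 'I_n -> R) :
  (forall i, is_derive t 1 (f i) (f' i)) ->
  is_derive t 1 (fun u => \sum_i f i u) (\sum_i f' i).
Proof.
move=> h.
have -> : (fun u => \sum_i f i u) = \sum_i f i.
  by apply/funext => u; rewrite fct_sumE.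
exact: is_derive_sum.
Qed.

Lemma is_derive_mul (f g : R -> R) (t df dg : R) :
  is_derive t 1 f df -> is_derive t 1 g dg ->
  is_derive t 1 (fun u => f u * g u) (df * g t + f t * dg).
Proof.
move=> hf hg; have := @is_deriveM R R f g t 1 df dg hf hg.
by move=> h; apply: is_derive_eq h _; rewrite addrC /GRing.scale /=; ring.
Qed.

Lemma mxderivM p q r (F : R -> 'M[R]_(p, q)) (G : R -> 'M[R]_(q, r)) t F' G' :
  mxderiv F t F' -> mxderiv G t G' ->
  mxderiv (fun u => F u *m G u) t (F' *m G t + F t *m G').
Proof.
move=> hF hG i j.
have -> : (fun u => (F u *m G u) i j) = (fun u => \sum_l F u i l * G u l j).
  by apply/funext => u; rewrite mxE.
have -> : (F' *m G t + F t *m G') i j = \sum_l (F' i l * G t l j + F t i l * G' l j).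
  by rewrite !mxE big_split.
by apply: is_derive_sum_fun => l; apply: is_derive_mul.
Qed.

Lemma mxderiv_cst p q (M : 'M[R]_(p, q)) t : mxderiv (fun _ => M) t 0.
Proof. by move=> i j; rewrite mxE; apply: is_derive_cst. Qed.

Lemma mxderiv_comp_affine p q (F : R -> 'M[R]_(p, q)) (a b t : R) F' :
  mxderiv F (a + b * t) F' -> mxderiv (fun u => F (a + b * u)) t (b *: F').
Proof.
move=> hF i j; rewrite mxE.
have hg : is_derive t 1 (fun u => a + b * u) b.
  have h := @is_deriveD R R R (cst a) (fun u => b * u) t 1 0 b (is_derive_cst _ _ _) _.
  rewrite add0r in h; apply: h.
  have h := @is_deriveZ R R R id b t 1 1 (is_derive_id _ _).
  by apply: is_derive_eq h _; rewrite /GRing.scale /= mulr1.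
have := @is_derive1_comp R (fun v => F v i j) (fun u => a + b * u) t _ _ (hF i j) hg.
by rewrite mulrC.
Qed.

Lemma mxderiv_eq p q (F G : R -> 'M[R]_(p, q)) t F' :
  F =1 G -> mxderiv F t F' -> mxderiv G t F'.
Proof. by move=> /funext ->. Qed.

Lemma mxderiv0_cst p q (F : R -> 'M[R]_(p, q)) :
  (forall t, mxderiv F t 0) -> forall s t, F s = F t.
Proof.
move=> h s t; apply/matrixP => i j.
apply: (@is_derive_0_is_cst R (fun u => F u i j)) => x.
by have := h x i j; rewrite mxE.
Qed.

Lemma exprZmx k (M : 'M[R]_k) t l : (t *: M) ^+ l = t ^+ l *: M ^+ l.
Proof.
elim: l => [|l IH]; first by rewrite !expr0 scale1r.
by rewrite !exprS IH -[LHS]scalemxAl -[X in t *: X]scalemxAr scalerA.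
Qed.

Lemma cvg_seq_eps (u : nat -> R) (l : R) :
  (forall e, 0 < e -> exists N0 : nat, forall N, (N0 <= N)%N -> `|u N - l| < e) ->
  u @ \oo --> l.
Proof.
move=> h; apply/cvgrPdist_lt => e e0; have [N0 H] := h e e0.
by exists N0 => // N hN; rewrite distrC; apply: H.
Qed.

(** Each entry is a power series in [u]; differentiating its coefficients replaces [M ^+ l] by
    [M ^+ l.+1], which factors out one [M]. Termwise differentiation needs convergence of the series
    and of its first two derived series at a point of modulus above [|t|], here [|t| + 1]. *)
Lemma mxderiv_expm k (M : 'M[R]_k) t :
  mxderiv (fun u => expm (u *: M)) t (M *m expm (t *: M)).
Proof.
move=> i j.
pose c (l : nat) : R := (l`!%:R)^-1 * (M ^+ l) i j.
pose a := n1 M.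
have a0 : 0 <= a by apply: n1_ge0.
have c1E l : pseries_diffs c l = (l`!%:R)^-1 * (M ^+ l.+1) i j.
  by rewrite /pseries_diffs /c factS natrM invfM mulrA mulVKf.
have c2E l : pseries_diffs (pseries_diffs c) l = (l`!%:R)^-1 * (M ^+ l.+2) i j.
  by rewrite {1}/pseries_diffs c1E factS natrM invfM mulrA mulVKf.
have bnd r l : `|(l`!%:R)^-1 * (M ^+ (l + r)%N) i j| <= a ^+ r * (a ^+ l / l`!%:R).
  rewrite normrM mulrC [X in _ * X]ger0_norm ?invr_ge0 // mulrA.
  apply: ler_wpM2r; first by rewrite invr_ge0.
  by rewrite -exprD addnC; apply: expr_entry_le.
have H0 K : cvgn (pseries c K).
  apply: (@cvg_pseries_fact _ _ (a ^+ 0) a) => // l.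
  by have := bnd 0 l; rewrite addn0.
have H1 K : cvgn (pseries (pseries_diffs c) K).
  apply: (@cvg_pseries_fact _ _ (a ^+ 1) a) => // l.
  by have := bnd 1 l; rewrite addn1 c1E.
have H2 K : cvgn (pseries (pseries_diffs (pseries_diffs c)) K).
  apply: (@cvg_pseries_fact _ _ (a ^+ 2) a) => // [|l]; first exact: exprn_ge0.
  by have := bnd 2 l; rewrite addn2 c2E.
have tK : `|t| < `| `|t| + 1 |.
  by rewrite [ltRHS]ger0_norm ?ltrDl // addr_ge0.
have := pseries_snd_diffs (H0 _) (H1 _) (H2 _) tK.
have -> : (fun x => limn (pseries c x)) = (fun u => expm (u *: M) i j).
  apply/funext => u; rewrite /expm mxE; congr (limn _); apply/funext => N.
  rewrite /pseries /series /= big_mkord; apply: eq_bigr => l _.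
  by rewrite exprZmx mxE /c -mulrA [X in _ * X]mulrC.
suff -> : limn (pseries (pseries_diffs c) t) = (M *m expm (t *: M)) i j by [].
apply: cvg_lim => //; apply: cvg_seq_eps => e e0.
have e'0 : 0 < e / (a + 1) by rewrite divr_gt0 // ltr_wpDl.
have [N0 H] := expm_psum_lim (t *: M) e'0; exists N0 => N hN.
have -> : pseries (pseries_diffs c) t N = (M *m expm_psum (t *: M) N) i j.
  rewrite /pseries /series /= big_mkord /expm_psum mulmx_sumr summxE.
  apply: eq_bigr => l _; rewrite c1E exprZmx -!scalemxAr !mxE exprS -mulrA.
  by congr (_ * _); rewrite mulrC; congr (_ * _); rewrite mxE.
have := le_n1 (M *m expm_psum (t *: M) N - M *m expm (t *: M)) i j.
rewrite [X in `|X| <= _]mxE [X in `|_ + X| <= _]mxE -mulmxBr => h; apply: le_lt_trans h _.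
apply: le_lt_trans (n1M _ _) _.
apply: (@le_lt_trans _ _ ((a + 1) * n1 (expm_psum (t *: M) N - expm (t *: M)))).
  by rewrite ler_wpM2r ?n1_ge0 // lerDl.
by rewrite mulrC -ltr_pdivlMr ?ltr_wpDl //; apply: H.
Qed.

Lemma expmZ_commute k (M : 'M[R]_k) t : expm (t *: M) *m M = M *m expm (t *: M).
Proof.
case: (eqVneq t 0) => [->|t0]; first by rewrite scale0r expm0 mulmx1 mul1mx.
have := expm_commute (t *: M); rewrite -scalemxAr -[X in _ = X]scalemxAl.
by move/scalerI; apply.
Qed.

(* Both the group law of [expm] and uniqueness for [F' = M F] come from the
   constancy of [expm (- u M) F(u)]. *)
Lemma expm_flow_unique k q (M : 'M[R]_k) (F : R -> 'M[R]_(k, q)) :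
  (forall t, mxderiv F t (M *m F t)) -> forall t, expm ((- t) *: M) *m F t = F 0.
Proof.
move=> hF t.
pose G u := expm ((- u) *: M) *m F u.
have -> : F 0 = G 0 by rewrite /G oppr0 scale0r expm0 mul1mx.
apply: (@mxderiv0_cst _ _ G) => u.
have hE : mxderiv (fun v => expm ((- v) *: M)) u ((-1) *: (M *m expm ((- u) *: M))).
  apply: (@mxderiv_eq _ _ (fun v => expm ((0 + (-1) * v) *: M))) => [v|].
    by rewrite add0r mulN1r.
  apply: (@mxderiv_comp_affine _ _ (fun v => expm (v *: M))).
  by have := @mxderiv_expm _ M (0 + (-1) * u); rewrite add0r mulN1r.
have := mxderivM hE (hF u).
suff -> : (-1 *: (M *m expm (- u *: M))) *m F u + expm (- u *: M) *m (M *m F u) = 0 by [].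
by rewrite scaleN1r mulNmx [in X in _ + X]mulmxA expmZ_commute addNr.
Qed.

Lemma expmNK k (M : 'M[R]_k) t : expm ((- t) *: M) *m expm (t *: M) = 1%:M.
Proof.
rewrite (@expm_flow_unique _ _ M (fun u => expm (u *: M))) ?scale0r ?expm0 //.
by move=> u; apply: mxderiv_expm.
Qed.

Lemma expmKN k (M : 'M[R]_k) t : expm (t *: M) *m expm ((- t) *: M) = 1%:M.
Proof. by rewrite -{1}(opprK t) expmNK. Qed.

Lemma expmDZ k (M : 'M[R]_k) s t :
  expm ((s + t) *: M) = expm (s *: M) *m expm (t *: M).
Proof.
have h : expm ((- s) *: M) *m expm ((s + t) *: M) = expm (t *: M).
  rewrite [s + t]addrC.
  rewrite (@expm_flow_unique _ _ M (fun u => expm ((t + u) *: M))) ?addr0 // => u.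
  apply: (@mxderiv_eq _ _ (fun v => expm ((t + 1 * v) *: M))) => [v|].
    by rewrite mul1r.
  have := @mxderiv_comp_affine _ _ (fun v => expm (v *: M)) t 1 u _ (@mxderiv_expm _ M _).
  by rewrite scale1r mul1r.
by rewrite -h mulmxA expmKN mul1mx.
Qed.

Lemma expm_unit k (M : 'M[R]_k) t : expm (t *: M) \in unitmx.
Proof. by have /mulmx1_unit[] := expmKN M t. Qed.

Lemma invmx_expm k (M : 'M[R]_k) t : invmx (expm (t *: M)) = expm ((- t) *: M).
Proof. by rewrite -[LHS]mul1mx -(expmNK M t) mulmxK // expm_unit. Qed.

Lemma expm_flowE k q (M : 'M[R]_k) (F : R -> 'M[R]_(k, q)) :
  (forall t, mxderiv F t (M *m F t)) ->
  forall c t, F (c + t) = expm (t *: M) *m F c.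
Proof.
move=> hF c t.
have <- : expm ((- t) *: M) *m F (c + t) = F c.
  rewrite (@expm_flow_unique _ _ M (fun u => F (c + u))) ?addr0 // => u.
  apply: (@mxderiv_eq _ _ (fun v => F (c + 1 * v))) => [v|]; first by rewrite mul1r.
  have := @mxderiv_comp_affine _ _ F c 1 u _ (hF _).
  by rewrite scale1r mul1r.
by rewrite mulmxA expmKN mul1mx.
Qed.

End ExpmDerivative.

(** * Exponential polynomials and their identity theorem *)

Section ExponentialPolynomials.
Context {R : realType}.

(* The linear functionals of solutions of constant-coefficient linear ODEs:
   an algebra of analytic functions for which the identity theorem is elementary. *)
Definition exppoly (f : R -> R) :=
  exists N (K : 'M[R]_N) (F : R -> 'cV[R]_N) (u : 'rV[R]_N),
    (forall t, mxderiv F t (K *m F t)) /\ forall t, f t = (u *m F t) 0 0.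

Lemma exppoly_cst c : exppoly (fun _ => c).
Proof.
exists 1, 0, (fun _ => 1%:M), c%:M; split=> t.
  by rewrite mul0mx; apply: mxderiv_cst.
by rewrite mulmx1 mxE eqxx mulr1n.
Qed.

Lemma exppolyD f g : exppoly f -> exppoly g -> exppoly (fun t => f t + g t).
Proof.
move=> [N [K [F [u [hF fE]]]]] [N' [K' [G [v [hG gE]]]]].
exists (N + N')%N, (block_mx K 0 0 K'), (fun t => col_mx (F t) (G t)), (row_mx u v).
split=> t; last by rewrite mul_row_col mxE fE gE.
rewrite mul_block_col !mul0mx addr0 add0r => i j.
rewrite mxE; under eq_fun do rewrite mxE.
by case: (fintype.split i) => i'; [apply: hF|apply: hG].
Qed.

(** The state of the product is the matrix [X = F *m G^T], which solves the linear equation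
    [X' = K *m X + X *m K'^T]; [mxvec] turns this into a vector system, the Kronecker sum of [K] and
    [K']. *)
Lemma exppolyM f g : exppoly f -> exppoly g -> exppoly (fun t => f t * g t).
Proof.
move=> [N [K [F [u [hF fE]]]]] [N' [K' [G [v [hG gE]]]]].
pose Lm (X : 'M[R]_(N, N')) := K *m X + X *m K'^T.
have Llin : linear Lm.
  move=> c X Y; rewrite /Lm mulmxDr mulmxDl -scalemxAr -scalemxAl scalerDr.
  by rewrite addrACA.
pose HLm := GRing.isLinear.Build _ _ _ _ Lm Llin.
pose L : {linear 'M[R]_(N, N') -> 'M[R]_(N, N')} := HB.pack Lm HLm.
pose lm (X : 'M[R]_(N, N')) := u *m X *m v^T.
have llin : linear lm.
  by move=> c X Y; rewrite /lm mulmxDr mulmxDl -scalemxAr -scalemxAl.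
pose Hlm := GRing.isLinear.Build _ _ _ _ lm llin.
pose l : {linear 'M[R]_(N, N') -> 'M[R]_(1, 1)} := HB.pack lm Hlm.
pose X t := F t *m (G t)^T.
exists (N * N')%N, (lin_mx L)^T, (fun t => (mxvec (X t))^T), (lin_mx l *m (mxvec (1%:M : 'M[R]_1))^T)^T.
split=> t; last first.
  rewrite -trmx_mul mxE mulmxA mul_vec_lin /=.
  have -> : lm (X t) = (f t * g t)%:M.
    rewrite /lm /X mulmxA -mulmxA -trmx_mul.
    rewrite [u *m _]mx11_scalar [v *m _]mx11_scalar -fE -gE tr_scalar_mx.
    by rewrite -scalar_mxM.
  have mxvec11 (Y : 'M[R]_1) (i : 'I_(1 * 1)) : mxvec Y 0 i = Y 0 0.
    by case/mxvec_indexP: i => i j; rewrite mxvecE !ord1.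
  rewrite mxE; under eq_bigr do rewrite mxE !mxvec11 !mxE eqxx mulr1 mulr1n.
  by rewrite big_const_ord /= addr0.
rewrite -trmx_mul mul_vec_lin /= => i j.
rewrite ord1 {j} mxE; under eq_fun do rewrite mxE.
case/mxvec_indexP: i => i j; rewrite mxvecE; under eq_fun do rewrite mxvecE.
have hGT : mxderiv (fun t => (G t)^T) t ((K' *m G t)^T).
  by move=> a b; rewrite mxE; under eq_fun do rewrite mxE; apply: hG.
have := mxderivM (hF t) hGT i j.
by rewrite /Lm trmx_mul !mulmxA.
Qed.

Lemma exppolyN f : exppoly f -> exppoly (fun t => - f t).
Proof.
move=> hf; have := exppolyM (exppoly_cst (-1)) hf.
by congr exppoly; apply/funext => t; rewrite mulN1r.
Qed.

Lemma exppoly_sum (I : Type) (r : seq I) (P : pred I) (f : I -> R -> R) :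
  (forall i, P i -> exppoly (f i)) -> exppoly (fun t => \sum_(i <- r | P i) f i t).
Proof.
move=> h; elim: r => [|i r IH].
  by under eq_fun do rewrite big_nil; apply: exppoly_cst.
under eq_fun do rewrite big_cons.
by case Pi: (P i) => //; apply: exppolyD; [apply: h|].
Qed.

Lemma exppoly_prod (I : Type) (r : seq I) (P : pred I) (f : I -> R -> R) :
  (forall i, P i -> exppoly (f i)) -> exppoly (fun t => \prod_(i <- r | P i) f i t).
Proof.
move=> h; elim: r => [|i r IH].
  by under eq_fun do rewrite big_nil; apply: exppoly_cst.
under eq_fun do rewrite big_cons.
by case Pi: (P i) => //; apply: exppolyM; [apply: h|].
Qed.

Definition exppoly_mx p q (F : R -> 'M[R]_(p, q)) :=
  forall i j, exppoly (fun t => F t i j).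

Lemma exppoly_mxM p q r (F : R -> 'M[R]_(p, q)) (G : R -> 'M[R]_(q, r)) :
  exppoly_mx F -> exppoly_mx G -> exppoly_mx (fun t => F t *m G t).
Proof.
move=> hF hG i j; under eq_fun do rewrite mxE.
by apply: exppoly_sum => l _; apply: exppolyM.
Qed.

Lemma exppoly_mx_cst p q (M : 'M[R]_(p, q)) : exppoly_mx (fun _ => M).
Proof. by move=> i j; apply: exppoly_cst. Qed.

Lemma exppoly_mxB p q (F G : R -> 'M[R]_(p, q)) :
  exppoly_mx F -> exppoly_mx G -> exppoly_mx (fun t => F t - G t).
Proof.
move=> hF hG i j; under eq_fun do rewrite 2!mxE.
by apply: exppolyD => //; apply: exppolyN.
Qed.

Lemma exppoly_det p (F : R -> 'M[R]_p) : exppoly_mx F -> exppoly (fun t => \det (F t)).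
Proof.
move=> hF; apply: exppoly_sum => s _; apply: exppolyM; first exact: exppoly_cst.
by apply: exppoly_prod => i _; apply: hF.
Qed.

Lemma exppoly_expm k (M : 'M[R]_k) a b : exppoly_mx (fun t => expm ((a + b * t) *: M)).
Proof.
move=> i j; exists k, (b *: M), (fun t => col j (expm ((a + b * t) *: M))), (delta_mx 0 i).
split=> t; last by rewrite -rowE !mxE.
move=> i' j'; set E := expm _.
have -> : (b *: M *m col j E) i' j' = (b *: (M *m E)) i' j.
  by rewrite -scalemxAl !mxE; congr (_ * _); apply: eq_bigr => l _; rewrite mxE.
under eq_fun do rewrite mxE.
exact: (@mxderiv_comp_affine _ _ _ (fun v => expm (v *: M)) a b t _ (@mxderiv_expm _ _ M _) i' j).
Qed.

Lemma exppoly_deriv N (K : 'M[R]_N) (F : R -> 'cV[R]_N) (u : 'rV[R]_N) :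
  (forall t, mxderiv F t (K *m F t)) -> forall t : R,
  is_derive t 1 (fun t : R => (u *m F t) 0 0) ((u *m K *m F t) 0 0).
Proof.
move=> hF t; have := mxderivM (@mxderiv_cst _ _ _ u t) (hF t) 0 0.
by rewrite mul0mx add0r mulmxA.
Qed.

Lemma exppoly_continuous f : exppoly f -> continuous f.
Proof.
move=> [N [K [F [u [hF fE]]]]] t.
have -> : f = (fun t => (u *m F t) 0 0) by apply/funext.
apply: differentiable_continuous; apply/derivable1_diffP.
by have [] := exppoly_deriv u hF t.
Qed.

(** On the interval all derivatives [u *m K ^+ l *m F t] vanish. Expanding the flow around the
    interior point [e / 2], every partial sum of [f] is then zero, and the exponential series
    converges at every time. *)
Lemma exppoly_identity f (e : R) : exppoly f -> 0 < e ->
  (forall t, 0 < t < e -> f t = 0) -> forall t, f t = 0.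
Proof.
move=> [N [K [F [u [hF fE]]]]] e0 f0.
have H l : forall t, 0 < t < e -> (u *m K ^+ l *m F t) 0 0 = 0.
  elim: l => [|l IH] t te; first by rewrite expr0 mulmx1 -fE f0.
  have h1 := exppoly_deriv (u *m K ^+ l) hF t.
  have h2 : is_derive t 1 (fun t => (u *m K ^+ l *m F t) 0 0) 0.
    apply: (@near_eq_is_derive _ _ _ (cst (0 : R))).
    have /near_in_itvoo : t \in `]0, e[%R by rewrite in_itv.
    by apply: filterS => v; rewrite in_itv /= => /IH ->.
  rewrite exprSr mulmxA.
  by rewrite -(@derive_val _ _ _ _ _ _ _ h1) (@derive_val _ _ _ _ _ _ _ h2).
have c0 : 0 < e / 2 < e by apply/andP; split; lra.
move=> t; rewrite fE -[t](subrK (e / 2)) addrC (expm_flowE hF).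
set c := e / 2; set M := _ *: K; set w := F c.
suff -> : u *m (expm M *m w) = 0 by rewrite mxE.
apply: n1_lt_eq0 => d d0.
have d'0 : 0 < d / ((n1 u + 1) * (n1 w + 1)).
  by rewrite divr_gt0 // mulr_gt0 // ltr_wpDl // n1_ge0.
have [n0 hn] := expm_psum_lim M d'0; have {}hn := hn n0 (leqnn _).
have P0 : u *m (expm_psum M n0 *m w) = 0.
  apply/matrixP => a b; rewrite !ord1 mulmxA /expm_psum mulmx_sumr mulmx_suml summxE mxE.
  apply: big1 => l _; rewrite /M exprZmx -!scalemxAr -!scalemxAl !mxE.
  by have := H l _ c0; rewrite mxE -/w => ->; rewrite !mulr0.
have -> : u *m (expm M *m w) = u *m ((expm M - expm_psum M n0) *m w).
  by rewrite mulmxBl mulmxBr P0 subr0.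
apply: le_trans (n1M _ _) _; apply: le_trans (ler_wpM2l (n1_ge0 _) (n1M _ _)) _.
rewrite n1_distC mulrCA mulrC.
have u0 := n1_ge0 u; have w0 := n1_ge0 w.
apply: (@le_trans _ _ (((n1 u + 1) * (n1 w + 1)) * n1 (expm_psum M n0 - expm M))).
  by rewrite ler_wpM2r ?n1_ge0 // ler_pM // lerDl.
by rewrite mulrC -ler_pdivlMr ?mulr_gt0 ?ltr_wpDl //; apply: ltW.
Qed.

End ExponentialPolynomials.

(** * Compactness, a Newton iteration, connectedness of the half-line *)

Section Compactness.
Context {R : realType}.

Lemma ultra_lim (U : set_system nat) (f : nat -> R) (C : R) : UltraFilter U ->
  (forall k, `|f k| <= C) ->
  exists p : R, forall e, 0 < e -> U [set k | `|f k - p| < e].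
Proof.
move=> UU fC.
have UC : U (f @^-1` `[- C, C]).
  by apply: filterE => k /=; rewrite in_itv /= -ler_norml.
have [p [_ hp]] := @segment_compact R (- C) C (f @ U) _ UC.
exists p => e e0; have [//|Uc] := in_ultra_setVsetC [set k | `|f k - p| < e] UU.
have h1 : (f @ U) [set y | ~ (`|y - p| < e)] by exact: Uc.
have h2 : nbhs p [set y : R | `|y - p| < e].
  by apply/nbhs_ballP; exists e => // y /=; rewrite /ball /= distrC.
by have [y [/= h3 h4]] := hp _ _ h1 h2.
Qed.

Lemma ultra_finite (U : set_system nat) (N : nat) (g : nat -> nat) : UltraFilter U ->
  (forall k, (g k < N)%N) -> exists d, U [set k | g k = d].
Proof.
move=> UU gN.
have : U [set k | (g k < N)%N].
  exact: filterE.
elim: N {gN} => [|N IH] UN; first by have /filter_ex[k /=] := UN.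
have [h|h] := in_ultra_setVsetC [set k | g k = N] UU; first by exists N.
by apply: IH; apply: filterS2 UN h => k /=; rewrite ltnS leq_eqVlt => /orP[/eqP|].
Qed.

(** One ultrafilter finer than the tails fixes all coordinate limits and the value of [D] at the
    same time, so no successive subsequences have to be extracted. *)
Lemma cluster_seq n (u : nat -> 'cV[R]_n) (C : R) T (D : nat -> T) (S : set T) :
  (forall k, n1 (u k) <= C) -> finite_set S -> (forall k, S (D k)) ->
  exists v d, forall e (K : nat), 0 < e ->
    exists k, [/\ (K <= k)%N, n1 (u k - v) < e & D k = d].
Proof.
move=> uC fS DS.
have [U [UU ooU]] := ultraFilterLemma eventually_filter.
have /finite_setP[N /card_set_bijP[g [gS ginj _]]] := fS.
have [c hc] := ultra_finite UU (fun k => gS _ (DS k)).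
have /choice[v hv] : forall i : 'I_n, exists p : R,
    forall e, 0 < e -> U [set k | `|u k i 0 - p| < e].
  by move=> i; apply: (ultra_lim UU) => k; apply: le_trans (uC k); apply: le_n1.
have [k0 /= hk0] := filter_ex hc.
exists (\col_i v i), (D k0) => e K e0.
have e'0 : 0 < e / (n * 1).+1%:R by rewrite divr_gt0.
have hall : U [set k | forall i, `|u k i 0 - v i| < e / (n * 1).+1%:R].
  by apply: filter_forall => i; apply: hv.
have hK : U [set k | (K <= k)%N] by apply: ooU; exists K.
have [k /= [[h1 h2] h3]] := filter_ex (filterI (filterI hall hK) hc).
exists k; split=> //.
  by apply: n1_sum_lt => // i j; rewrite !ord1 !mxE; apply: h1.
by apply: ginj; rewrite ?inE //; rewrite h3 hk0.
Qed.

Lemma cluster_seq1 n (u : nat -> 'cV[R]_n) (C : R) : (forall k, n1 (u k) <= C) ->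
  exists v, forall e (K : nat), 0 < e -> exists k, (K <= k)%N /\ n1 (u k - v) < e.
Proof.
move=> uC.
have [v [c h]] := @cluster_seq n u C unit (fun _ => tt) setT uC (finite_finset (X := [set: unit])) (fun _ => I).
by exists v => e K e0; have [k [? ? _]] := h e K e0; exists k.
Qed.

(* Newton iteration with the derivative frozen to the identity. *)
Lemma near_id_surj n (f : 'cV[R]_n -> 'cV[R]_n) (r : R) : 0 < r ->
  (forall a b, n1 a <= r -> n1 b <= r ->
     n1 (f a - f b - (a - b)) <= (1 / 2) * n1 (a - b)) ->
  forall y, n1 (y - f 0) <= r / 2 -> exists a, n1 a <= r /\ f a = y.
Proof.
move=> r0 hf y hy.
pose u := fix u (k : nat) : 'cV[R]_n :=
  if k is k'.+1 then u k' + (y - f (u k')) else 0.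
have u0 : u 0 = 0 by [].
have uS k : u k.+1 = u k + (y - f (u k)) by [].
(* The residual halves at each step and equals the next increment, so the increments sum to less
   than [r] and the iterates never leave the ball. *)
have H k : n1 (u k) <= r * (1 - (1 / 2) ^+ k) /\
           n1 (y - f (u k)) <= (r / 2) * (1 / 2) ^+ k.
  elim: k => [|k [IH1 IH2]].
    by rewrite /= n1_0 expr0 subrr mulr0 mulr1.
  have p0 : 0 < (1 / 2 : R) ^+ k by rewrite exprn_gt0.
  have p1 : (1 / 2 : R) ^+ k <= 1 by apply: exprn_ile1; lra.
  have U1 : n1 (u k.+1) <= r * (1 - (1 / 2) ^+ k.+1).
    rewrite uS; apply: le_trans (n1D _ _) _; apply: le_trans (lerD IH1 IH2) _.
    by rewrite exprS; lra.
  split=> //.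
  have E : y - f (u k.+1) = - (f (u k.+1) - f (u k) - (u k.+1 - u k)).
    have -> : u k.+1 - u k = y - f (u k) by rewrite uS [u k + _]addrC addrK.
    by rewrite 2!opprB addrA subrK.
  rewrite E n1N; apply: le_trans (hf _ _ _ _) _.
  - by apply: le_trans U1 _; rewrite exprS; nra.
  - by apply: le_trans IH1 _; nra.
  - by rewrite uS [u k + _]addrC addrK exprS; lra.
have ur k : n1 (u k) <= r.
  have [h _] := H k; apply: le_trans h _.
  have P : 0 <= (1 / 2 : R) ^+ k by apply: exprn_ge0; lra.
  by nra.
have [a ha] := cluster_seq1 ur.
have ar : n1 a <= r.
  apply/ler_addgt0Pr => e e0; have [k [_ hk]] := ha e 0 e0.
  rewrite -(subrK (u k) a); apply: le_trans (n1D _ _) _.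
  by rewrite addrC lerD // n1_distC ltW.
exists a; split=> //; apply/esym/subr0_eq/n1_lt_eq0 => e e0.
have e'0 : 0 < e / 4 by lra.
have [K hK] : exists K : nat, forall k, (K <= k)%N -> (r / 2) * (1 / 2) ^+ k <= e / 4.
  have : (fun k => (1 / 2 : R) ^+ k) @ \oo --> (0 : R).
    by apply: cvg_expr; rewrite ger0_norm; lra.
  move=> /cvgr0_norm_lt /(_ (e / (2 * r))) [|K _ hK].
    by rewrite divr_gt0 // mulr_gt0.
  exists K => k /hK /=; have P : 0 <= (1 / 2 : R) ^+ k by apply: exprn_ge0; lra.
  by rewrite (ger0_norm P) ltr_pdivlMr ?mulr_gt0 // => h; lra.
have [k [Kk hk]] := ha _ K e'0.
have := hf (u k) a (ur k) ar; set z := _ - _ - _ => hz.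
have -> : y - f a = (y - f (u k)) + z + (u k - a).
  by rewrite -[RHS]addrA /z subrK addrA subrK.
apply: le_trans (n1D _ _) _.
apply: le_trans (lerD (n1D _ _) (lexx _)) _.
have [_ h1] := H k; have := hK k Kk; lra.
Qed.

(** Connectedness: the supremum of the points of [[0, c]] equivalent to 0 is again equivalent to 0,
    because its class is open, and for the same reason it cannot lie below [c]. *)
Lemma equiv_open_line (E : R -> R -> Prop) :
  (forall a, E a a) -> (forall a b, E a b -> E b a) ->
  (forall a b c, E a b -> E b c -> E a c) ->
  (forall a, exists2 r, 0 < r & forall b, `|b - a| < r -> E a b) ->
  forall c, 0 <= c -> E 0 c.
Proof.
move=> Er Es Et El c c0.
pose S := [set x : R | 0 <= x <= c /\ E 0 x].
have S0 : S 0 by split=> //; rewrite lexx c0.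
have hS : has_sup S.
  by split; [exists 0|exists c => x [/andP[]]].
set s := sup S.
have s0 : 0 <= s by apply: ub_le_sup => //; case: hS.
have sc : s <= c by apply: ge_sup; [exists 0|move=> x [/andP[]]].
have [r r0 hr] := El s.
have [x Sx xs] := sup_adherent r0 hS.
have xs' : x <= s by apply: ub_le_sup => //; case: hS.
have E0s : E 0 s.
  apply: Et (proj2 Sx) (Es _ _ (hr _ _)).
  by rewrite -normrN opprB ger0_norm ?subr_ge0 // -/s in xs *; lra.
have [->//|/eqP sNc] := eqVneq c s.
have {}sc : s < c by rewrite lt_neqAle sc andbT eq_sym; apply/eqP.
pose y := Num.min c (s + r / 2).
have sy : s < y by rewrite lt_min sc ltrDl; lra.
have yr : y <= s + r / 2 by rewrite ge_min lexx orbT.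
suff : S y by move/(ub_le_sup (proj2 hS)); rewrite leNgt sy.
split; first by rewrite ge_min lexx /= andbT ltW // (le_lt_trans s0).
apply: Et E0s (hr _ _); rewrite ger0_norm; lra.
Qed.

End Compactness.

(** * Bounded linear maps and closed subspaces *)

Section LinearMaps.
Context {R : realType}.

Lemma n1_sum (I : Type) (r : seq I) (P : pred I) p q (F : I -> 'M[R]_(p, q)) :
  n1 (\sum_(i <- r | P i) F i) <= \sum_(i <- r | P i) n1 (F i).
Proof.
elim/big_ind2: _ => // [|A a B b hA hB]; first by rewrite n1_0.
by apply: le_trans (n1D _ _) _; rewrite lerD.
Qed.

Lemma linear_bounded p q r s (f : {linear 'M[R]_(p, q) -> 'M[R]_(r, s)}) :
  exists2 C, 0 <= C & forall X, n1 (f X) <= C * n1 X.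
Proof.
exists (\sum_i \sum_j n1 (f (delta_mx i j))).
  by apply: sumr_ge0 => i _; apply: sumr_ge0 => j _; apply: n1_ge0.
move=> X; rewrite {1}(matrix_sum_delta X) linear_sum.
apply: le_trans (n1_sum _ _ _) _; rewrite mulr_suml; apply: ler_sum => i _.
rewrite linear_sum; apply: le_trans (n1_sum _ _ _) _.
rewrite mulr_suml; apply: ler_sum => j _.
rewrite linearZ n1Z mulrC ler_wpM2l ?n1_ge0 //; exact: le_n1.
Qed.

(** [W] is the kernel of the bounded map [1 - projv W]. *)
Lemma vspace_closed p q (W : {vspace 'M[R]_(p, q)}) (Y : 'M[R]_(p, q)) :
  (forall e, 0 < e -> exists2 Y', Y' \in W & n1 (Y - Y') <= e) -> Y \in W.
Proof.
move=> h.
have [C C0 hC] := linear_bounded (\1%VF - projv W)%VF.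
suff : (\1%VF - projv W)%VF Y = 0.
  rewrite add_lfunE opp_lfunE id_lfunE => /eqP; rewrite subr_eq0 => /eqP ->.
  exact: memv_proj.
apply: n1_lt_eq0 => e e0.
have e'0 : 0 < e / (C + 1) by rewrite divr_gt0 // ltr_wpDl.
have [Y' YW hY] := h _ e'0.
have -> : (\1%VF - projv W)%VF Y = (\1%VF - projv W)%VF (Y - Y').
  have f0 : (\1%VF - projv W)%VF Y' = 0.
    by rewrite add_lfunE opp_lfunE id_lfunE projv_id // subrr.
  by rewrite [RHS]linearB /= f0 subr0.
apply: le_trans (hC _) _.
apply: (@le_trans _ _ ((C + 1) * (e / (C + 1)))).
  by rewrite ler_pM ?n1_ge0 // lerDl.
by rewrite mulrC divfK // gt_eqF // ltr_wpDl.
Qed.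

Lemma mxderiv_lim p q (F : R -> 'M[R]_(p, q)) t F' : mxderiv F t F' ->
  forall e, 0 < e -> exists2 d, 0 < d &
    forall h, h != 0 -> `|h| < d -> n1 (h^-1 *: (F (t + h) - F t) - F') < e.
Proof.
move=> hF e e0; have e'0 : 0 < e / (p * q).+1%:R by rewrite divr_gt0.
have : \forall h \near (0 : R)^', forall ij : 'I_p * 'I_q,
   `|h^-1 * (F (t + h) ij.1 ij.2 - F t ij.1 ij.2) - F' ij.1 ij.2| < e / (p * q).+1%:R.
  apply: filter_forall => -[i j] /=; have [hd hv] := hF i j.
  move/cvgr_distC_lt: hd => /(_ _ e'0); apply: filterS => h /=.
  by rewrite -hv /derive /GRing.scale /= mulr1 [h + t]addrC.
move=> /nbhs_ballP[d /= d0 hd]; exists d => // h h0 hh.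
apply: n1_sum_lt => // i j; rewrite !mxE.
by apply: (hd h _ h0 (i, j)); rewrite /ball /= sub0r normrN.
Qed.

End LinearMaps.

(** * Words of constant controls and their tangent directions *)

Section Words.
Context {R : realType}.
Variables (m k : nat) (M : 'cV[R]_m -> 'M[R]_k) (Om : set 'cV[R]_m).
Implicit Types (s : seq ('cV[R]_m * R)) (p : 'cV[R]_m * R).

(** Convertible to [Phi] for [M = Au] and to [gel] for [M = Mhat], so that both systems share one
    theory. *)
Definition gl s : 'M[R]_k :=
  foldl (fun g p => expm (p.2 *: M p.1) *m g) 1%:M s.

Lemma gl_cons p s : gl (p :: s) = gl s *m expm (p.2 *: M p.1).
Proof.
have H s' (X : 'M[R]_k) :
    foldl (fun g p => expm (p.2 *: M p.1) *m g) X s' = gl s' *m X.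
  rewrite /gl; elim/last_ind: s' => [|s' q IH] /=; first by rewrite mul1mx.
  by rewrite -cats1 !foldl_cat /= IH mulmxA.
by rewrite /gl /= H mulmx1.
Qed.

Lemma gl_cat s1 s2 : gl (s1 ++ s2) = gl s2 *m gl s1.
Proof.
elim: s1 => [|p s1 IH]; first by rewrite /gl /= mulmx1.
by rewrite cat_cons !gl_cons IH mulmxA.
Qed.

Lemma gl_unit s : gl s \in unitmx.
Proof.
elim: s => [|p s IH]; first exact: unitmx1.
by rewrite gl_cons unitmx_mul IH expm_unit.
Qed.

(** The adjoint action of the inverse of [g], hence contravariant in [g]. *)
Definition conj_by (g X : 'M[R]_k) := invmx g *m X *m g.

Lemma conj_byM (a b X : 'M[R]_k) : a \in unitmx -> b \in unitmx ->
  conj_by b (conj_by a X) = conj_by (a *m b) X.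
Proof.
move=> ua ub; rewrite /conj_by.
have -> : invmx (a *m b) = invmx b *m invmx a.
  have uab : a *m b \in unitmx by rewrite unitmx_mul ua.
  have e : (invmx b *m invmx a) *m (a *m b) = 1%:M.
    by rewrite -mulmxA (mulmxA (invmx a)) mulVmx // mul1mx mulVmx.
  by rewrite -[RHS](mulmxK uab) e mul1mx.
by rewrite !mulmxA.
Qed.

Lemma conj_by_is_linear g : linear (conj_by g).
Proof.
by move=> c X Y; rewrite /conj_by mulmxDr mulmxDl -scalemxAr -scalemxAl.
Qed.
HB.instance Definition _ g := GRing.isLinear.Build _ _ _ _ (conj_by g) (conj_by_is_linear g).

(* The partial derivative of [gl s] in the i-th duration is [gl s] times the
   i-th entry of [dirs s]. *)
Fixpoint dirs s : seq 'M[R]_k :=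
  if s is p :: s' then M p.1 :: map (conj_by (expm (p.2 *: M p.1))) (dirs s') else [::].

Lemma size_dirs s : size (dirs s) = size s.
Proof. by elim: s => //= p s <-; rewrite size_map. Qed.

Lemma dirs_cat s1 s2 : dirs (s1 ++ s2) = dirs s1 ++ map (conj_by (gl s1)) (dirs s2).
Proof.
elim: s1 => [|p s1 IH] /=.
  by rewrite -[LHS]map_id; apply: eq_map => X; rewrite /conj_by /gl /= invmx1 mul1mx mulmx1.
rewrite IH map_cat -map_comp; congr (_ :: _ ++ _); apply: eq_map => X /=.
by rewrite gl_cons conj_byM ?gl_unit ?expm_unit.
Qed.

(** As [Z *m gl s = gl s *m conj_by (gl s) Z], this says that the duration derivatives of [gl s]
    span every [Z *m gl s]. In this form [Z] acts at the end state of the word, where the rank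
    condition is applied. *)
Definition full s := forall Z, liealg [set M w | w in Om] Z ->
  conj_by (gl s) Z \in <<dirs s>>%VS.

Lemma total_time_cat s1 s2 : total_time (s1 ++ s2) = total_time s1 + total_time s2.
Proof. by rewrite /total_time big_cat. Qed.

Lemma admissible_cat s1 s2 :
  admissible Om s1 -> admissible Om s2 -> admissible Om (s1 ++ s2).
Proof. by move=> h1 h2 p; rewrite mem_cat => /orP[/h1|/h2]. Qed.

Lemma admissible1 w t : Om w -> 0 < t -> admissible Om [:: (w, t)].
Proof. by move=> hw ht p; rewrite inE => /eqP ->. Qed.

Lemma total_time_ge0 s : admissible Om s -> 0 <= total_time s.
Proof.
by move=> h; rewrite /total_time big_seq; apply: sumr_ge0 => p /h[_ /ltW].
Qed.

Section AdInvariance.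
Variables (s0 : seq ('cV[R]_m * R)) (W : {vspace 'M[R]_k}).

(** Membership is required after every short word [g], not just the empty one: appending one more
    piece to [g] and differentiating then yields brackets. *)
Let Q X := exists2 e, 0 < e & forall g, admissible Om g -> total_time g < e ->
  conj_by (gl s0) (conj_by (gl g) X) \in W.

Lemma shortD X Y : Q X -> Q Y -> Q (X + Y).
Proof.
move=> [e e0 he] [f f0 hf]; exists (Num.min e f); first by rewrite lt_min e0.
move=> g ag; rewrite lt_min => /andP[ge gf].
by rewrite !linearD /= memvD // (he, hf).
Qed.

Lemma shortZ c X : Q X -> Q (c *: X).
Proof.
by move=> [e e0 he]; exists e => // g ag ge; rewrite !linearZ /= memvZ // he.
Qed.

(** The bracket is, up to sign, the derivative at [h = 0] of conjugation by a final piece [(w, h)].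
    The difference quotients for small [h > 0] lie in [W], which is closed; halving [e] leaves time
    for that piece. *)
Lemma short_bracket w X : Om w -> Q X -> Q (M w *m X - X *m M w).
Proof.
move=> hw [e e0 he]; exists (e / 2); first by lra.
move=> g ag ge.
pose T Y := conj_by (gl s0) (conj_by (gl g) Y).
have TB Y Y' : T (Y - Y') = T Y - T Y' by rewrite /T linearB /= linearB.
have TZ c Y : T (c *: Y) = c *: T Y by rewrite /T linearZ /= linearZ.
have TW : T X \in W by apply: he => //; lra.
have hY : mxderiv (fun t => expm ((- t) *: M w) *m X *m expm (t *: M w)) 0
    (- (M w *m X - X *m M w)).
  have h1 : mxderiv (fun t => expm ((- t) *: M w)) 0 ((-1) *: (M w *m expm ((-0) *: M w))).
    apply: (@mxderiv_eq _ _ _ (fun v => expm ((0 + (-1) * v) *: M w))) => [v|].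
      by rewrite add0r mulN1r.
    apply: (@mxderiv_comp_affine _ _ _ (fun v => expm (v *: M w))).
    by have := @mxderiv_expm _ _ (M w) (0 + (-1) * 0); rewrite add0r mulN1r.
  have h2 := mxderivM (mxderivM h1 (@mxderiv_cst _ _ _ X 0)) (@mxderiv_expm _ _ (M w) 0).
  move: h2; rewrite oppr0 scale0r expm0 !mulmx0 !mulmx1 !mul1mx addr0.
  by rewrite scaleN1r mulNmx opprB addrC.
have [C C0 hC] := linear_bounded (conj_by (gl s0)).
have [C' C'0 hC'] := linear_bounded (conj_by (gl g)).
rewrite -[_ - _]opprK -scaleN1r !linearZ /= memvZ //.
apply: vspace_closed => d d0.
have d'0 : 0 < d / (C * C' + 1) by rewrite divr_gt0 // ltr_wpDl // mulr_ge0.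
have [r r0 hr] := mxderiv_lim hY d'0.
pose h := Num.min (r / 2) (e / 4).
have h0 : 0 < h by rewrite lt_min; apply/andP; split; lra.
have hr' : h <= r / 2 by rewrite ge_min lexx.
have he' : h <= e / 4 by rewrite ge_min lexx orbT.
have := hr h; rewrite gt_eqF // gtr0_norm // => /(_ isT) hn.
have {}hn : n1 (h^-1 *: (expm (- h *: M w) *m X *m expm (h *: M w) - X) -
    - (M w *m X - X *m M w)) < d / (C * C' + 1).
  have := hn _; rewrite add0r oppr0 scale0r expm0 mul1mx mulmx1; apply; lra.
exists (h^-1 *: (T (expm (- h *: M w) *m X *m expm (h *: M w)) - T X)).
  rewrite memvZ // memvB //.
  have := he (g ++ [:: (w, h)]).
  rewrite gl_cat gl_cons {1}/gl /= mul1mx -conj_byM ?gl_unit ?expm_unit //.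
  rewrite {3}/conj_by invmx_expm; apply.
    by apply: admissible_cat => //; apply: admissible1.
  by rewrite total_time_cat {2}/total_time big_seq1 /=; lra.
rewrite n1_distC.
have -> : h^-1 *: (T (expm (- h *: M w) *m X *m expm (h *: M w)) - T X) -
    conj_by (gl s0) (conj_by (gl g) (- (M w *m X - X *m M w))) =
    T (h^-1 *: (expm (- h *: M w) *m X *m expm (h *: M w) - X) - - (M w *m X - X *m M w)).
  by rewrite TB TZ TB.
apply: le_trans (hC _) _; apply: le_trans (ler_wpM2l C0 (hC' _)) _; rewrite mulrA.
apply: (@le_trans _ _ ((C * C' + 1) * (d / (C * C' + 1)))).
  by rewrite ler_pM ?mulr_ge0 ?n1_ge0 ?lerDl // ltW.
by rewrite mulrC divfK // gt_eqF // ltr_wpDl // mulr_ge0.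
Qed.

Lemma short_liealg : (forall w, Om w -> Q (M w)) ->
  forall Z, liealg [set M w | w in Om] Z -> Q Z.
Proof.
move=> Qgen.
have Q0 : Q 0 by exists 1 => // g _ _; rewrite !linear0 mem0v.
(* [liealg] brackets arbitrary elements, whereas [short_bracket] has a generator on the left. The
   gap is closed by an induction on [Z] whose bracket case is the Jacobi identity. *)
have H Z : liealg [set M w | w in Om] Z -> forall X, Q X -> Q (Z *m X - X *m Z).
  elim=> {Z} [_ [w hw <-]||Z1 Z2 _ H1 _ H2|c Z _ H|Z1 Z2 _ H1 _ H2] X QX.
  - exact: short_bracket.
  - by rewrite mul0mx mulmx0 subr0.
  - rewrite mulmxDl mulmxDr opprD addrACA; apply: shortD; [exact: H1|exact: H2].
  - by rewrite -scalemxAl -scalemxAr -scalerBr; apply: shortZ; apply: H.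
  - have h1 := H1 _ (H2 _ QX); have h2 := shortZ (-1) (H2 _ (H1 _ QX)).
    have := shortD h1 h2; rewrite scaleN1r.
    congr Q; rewrite !(mulmxBl, mulmxBr) !mulmxA !opprB.
    set a := Z1 *m Z2 *m X; set b := Z1 *m X *m Z2; set c := Z2 *m X *m Z1.
    set d := X *m Z2 *m Z1; set e := Z2 *m Z1 *m X; set f := X *m Z1 *m Z2.
    by apply/matrixP => i j; rewrite !mxE; ring.
move=> Z; elim=> {Z} [_ [w hw <-]||Z1 Z2 _ H1 _ H2|c Z _ HZ|Z1 Z2 L1 _ _ H2] //.
- exact: Qgen.
- exact: shortD.
- exact: shortZ.
- exact: H.
Qed.

End AdInvariance.

(* Krener's argument: a word whose span of partial derivatives has maximal
   dimension among the short words cannot be improved by any short extension. *)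
Lemma full_exists w0 : Om w0 -> forall e, 0 < e ->
  exists s, [/\ s != [::], admissible Om s, total_time s < e & full s].
Proof.
move=> Om0 e e0.
pose P (r : nat) := `[< exists s, [/\ s != [::], admissible Om s, total_time s < e &
  \dim <<dirs s>>%VS = r] >].
have exP : exists r, P r.
  exists (\dim <<dirs [:: (w0, e / 2)]>>%VS); apply/asboolP; exists [:: (w0, e / 2)].
  split=> //; first by apply: admissible1 => //; lra.
  by rewrite /total_time big_seq1 /=; lra.
have Pub r : P r -> (r <= \dim (fullv : {vspace 'M[R]_k}))%N.
  by move=> /asboolP[s [_ _ _ <-]]; apply/dimvS/subvf.
case: (ex_maxnP exP Pub) => r /asboolP[s [sN sa st sr]] rmax.
exists s; split=> // Z LZ.
set W := <<dirs s>>%VS.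
have gens w : Om w -> exists2 e, 0 < e & forall g, admissible Om g -> total_time g < e ->
    conj_by (gl s) (conj_by (gl g) (M w)) \in W.
  move=> hw; exists (e - total_time s) => [|g ag gt]; first by rewrite subr_gt0.
  pose tau := (e - total_time s - total_time g) / 2.
  have tau0 : 0 < tau by rewrite /tau; lra.
  (* The directions of [s] remain a prefix and the last direction of [s'] is the wanted conjugate of
     [M w]; maximality of the dimension leaves no room for it outside [W]. The choice of [tau] keeps
     the total time below [e]. *)
  pose s' := s ++ g ++ [:: (w, tau)].
  have WS : (W <= <<dirs s'>>)%VS by rewrite /s' dirs_cat span_cat addvSl.
  have s'P : P (\dim <<dirs s'>>%VS).
    apply/asboolP; exists s'; split=> //.
    - by rewrite /s'; case: (s) sN.
    - by do 2 apply: admissible_cat => //; apply: admissible1.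
    - rewrite !total_time_cat {3}/total_time big_seq1 /= /tau; lra.
  have /eqP <- : <<dirs s'>>%VS == W.
    rewrite eq_sym -(geq_leqif (dimv_leqif_eq WS)) [leqRHS]sr; exact: rmax.
  apply: memv_span; rewrite /s' dirs_cat mem_cat; apply/orP; right.
  apply: map_f; rewrite dirs_cat mem_cat; apply/orP; right.
  by apply: map_f; rewrite /= inE.
have [d d0 hd] := short_liealg gens LZ.
have := hd [::]; rewrite /total_time big_nil {2}/conj_by {2 3}/gl /= invmx1 mul1mx mulmx1.
by apply.
Qed.

(** A piece of duration [t] contributes [2 * K * t], and its product with the earlier error, which
    is at most 1, contributes as much again; this gives the constant 4. *)
Lemma gl_near1 K s : 0 <= K -> (forall w, Om w -> n1 (M w) <= K) -> admissible Om s ->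
  4 * K * total_time s <= 1 -> n1 (gl s - 1%:M) <= 4 * K * total_time s.
Proof.
move=> K0 hK; elim: s => [|[w t] s IH] ad; rewrite /total_time.
  by rewrite big_nil mulr0 /gl /= subrr n1_0.
rewrite big_cons -/(total_time s) /= => hT.
have ads : admissible Om s by move=> p ps; apply: ad; rewrite inE ps orbT.
have [hw /= t0] := ad (w, t) (mem_head _ _).
have T0 := total_time_ge0 ads.
have Kt : 0 <= K * t by rewrite mulr_ge0 // ltW.
have KT : 0 <= K * total_time s by rewrite mulr_ge0.
have bIH : n1 (gl s - 1%:M) <= 4 * K * total_time s by apply: IH => //; lra.
have tw : n1 (t *: M w) <= K * t.
  by rewrite n1Z gtr0_norm // mulrC ler_wpM2r ?hK // ltW.
have a : n1 (expm (t *: M w) - 1%:M) <= 2 * (K * t).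
  by apply: le_trans (n1_expm1 _) _; lra.
rewrite gl_cons /=; set E := expm _ in a *; set G := gl s in bIH *.
have -> : G *m E - 1%:M = (G - 1%:M) *m (E - 1%:M) + (E - 1%:M) + (G - 1%:M).
  by rewrite mulmxBl mul1mx subrK mulmxBr mulmx1 addrA subrK.
apply: le_trans (n1D _ _) _; apply: le_trans (lerD (n1D _ _) (lexx _)) _.
have := n1M (G - 1%:M) (E - 1%:M); have := n1_ge0 (E - 1%:M); have := n1_ge0 (G - 1%:M).
move: (n1 (G - 1%:M)) (n1 (E - 1%:M)) (n1 _) bIH a => b a c; nra.
Qed.

End Words.

(** * Strict differentiability at the origin *)

Section StrictDifferentiability.
Context {R : realType}.

Lemma small_mul (C e : R) : 0 <= C -> 0 < e ->
  exists2 d, 0 < d & forall d', d' <= d -> C * d' <= e.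
Proof.
move=> C0 e0; exists (e / (C + 1)); first by rewrite divr_gt0 // ltr_wpDl.
move=> d' /(ler_wpM2l C0) h; apply: le_trans h _.
rewrite mulrA ler_pdivrMr ?ltr_wpDl // mulrC ler_pM2l // lerDl; exact: ler01.
Qed.

Variables (n k : nat).
Implicit Types F G DF DG : 'cV[R]_n -> 'M[R]_k.

(** Two arbitrary points near 0 are compared, because the contraction hypothesis of [near_id_surj]
    is of this kind. Only a linear bound on [DF] is recorded. *)
Definition sdiff F DF :=
  (exists2 C, 0 <= C & forall h, n1 (DF h) <= C * n1 h) /\
  forall e, 0 < e -> exists2 d, 0 < d & forall a b, n1 a <= d -> n1 b <= d ->
    n1 (F a - F b - DF (a - b)) <= e * n1 (a - b).

Lemma sdiff_cst X : sdiff (fun _ => X) (fun _ => 0).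
Proof.
split; first by exists 0 => // h; rewrite n1_0 mul0r.
move=> e e0; exists 1 => // a b _ _.
by rewrite subrr subr0 n1_0 mulr_ge0 ?n1_ge0 // ltW.
Qed.

Lemma sdiff_near F DF : sdiff F DF -> forall e, 0 < e -> exists2 d, 0 < d &
  forall a, n1 a <= d -> n1 (F a - F 0) <= e.
Proof.
move=> [[C C0 hC] hF] e e0.
have [d1 d10 h1] := hF 1 ltr01.
have [d2 d20 h2] := @small_mul (1 + C) e (addr_ge0 ler01 C0) e0.
exists (Num.min d1 d2) => [|a]; first by rewrite lt_min d10.
rewrite le_min => /andP[ad1 ad2].
have := h1 a 0 ad1; rewrite n1_0 subr0 mul1r => /(_ (ltW d10)) h.
rewrite -(subrK (DF a) (F a - F 0)); apply: le_trans (n1D _ _) _.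
apply: le_trans (lerD h (hC a)) _; rewrite -{1}[n1 a]mul1r -mulrDl; exact: h2.
Qed.

Lemma sdiffM F DF G DG : sdiff F DF -> sdiff G DG ->
  sdiff (fun a => F a *m G a) (fun h => DF h *m G 0 + F 0 *m DG h).
Proof.
move=> sF sG; have nF := sdiff_near sF; have nG := sdiff_near sG.
case: sF => -[C C0 hC] hF; case: sG => -[C' C'0 hC'] hG.
have f0 := n1_ge0 (F 0); have g0 := n1_ge0 (G 0).
split.
  exists (C * n1 (G 0) + n1 (F 0) * C') => [|h]; first by rewrite addr_ge0 ?mulr_ge0.
  apply: le_trans (n1D _ _) _; apply: le_trans (lerD (n1M _ _) (n1M _ _)) _.
  rewrite mulrDl mulrAC -mulrA lerD // ?mulrA ?ler_wpM2r //.
  by rewrite -mulrA ler_wpM2l.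
move=> e e0.
pose B := n1 (F 0) + n1 (G 0) + C + C' + 2.
have B0 : 0 <= B by rewrite /B !addr_ge0.
(* The 4 counts the summands of the splitting below, each bounded by [B * c1 * n1 x]; [c1] is capped
   at 1 so that [B] bounds [G a] and [F b]. *)
have [c c0 hc] := @small_mul (4 * B) e (mulr_ge0 (ler0n _ 4) B0) e0.
have {}hc := hc c (lexx _).
pose c1 := Num.min c 1; have c10 : 0 < c1 by rewrite lt_min c0 ltr01.
have c1c : c1 <= c by rewrite ge_min lexx.
have c11 : c1 <= 1 by rewrite ge_min lexx orbT.
have [d1 d10 h1] := hF c1 c10; have [d2 d20 h2] := hG c1 c10.
have [d3 d30 h3] := nF c1 c10; have [d4 d40 h4] := nG c1 c10.
pose d := Num.min (Num.min d1 d2) (Num.min d3 d4).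
exists d; first by rewrite !lt_min d10 d20 d30.
move=> a b; rewrite !le_min => /andP[/andP[a1 a2] /andP[a3 a4]] /andP[/andP[b1 b2] /andP[b3 b4]].
set x := a - b.
have -> : F a *m G a - F b *m G b - (DF x *m G 0 + F 0 *m DG x) =
    (F a - F b - DF x) *m G a + DF x *m (G a - G 0) +
    F b *m (G a - G b - DG x) + (F b - F 0) *m DG x.
  rewrite !(mulmxBl, mulmxBr).
  apply/matrixP => i j; rewrite !mxE; ring.
have Ga : n1 (G a) <= B.
  rewrite -(subrK (G 0) (G a)); apply: le_trans (n1D _ _) _.
  have := h4 a a4; rewrite /B; lra.
have Fb : n1 (F b) <= B.
  rewrite -(subrK (F 0) (F b)); apply: le_trans (n1D _ _) _.
  have := h3 b b3; rewrite /B; lra.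
have x0 : 0 <= n1 x := n1_ge0 _.
have t1 : n1 ((F a - F b - DF x) *m G a) <= B * c1 * n1 x.
  apply: le_trans (n1M _ _) _; rewrite mulrC -mulrA.
  by apply: ler_pM (n1_ge0 _) (n1_ge0 _) Ga (h1 _ _ a1 b1).
have t2 : n1 (DF x *m (G a - G 0)) <= B * c1 * n1 x.
  apply: le_trans (n1M _ _) _; rewrite [leRHS]mulrAC.
  apply: ler_pM (n1_ge0 _) (n1_ge0 _) _ (h4 _ a4).
  by apply: le_trans (hC _) _; rewrite ler_wpM2r // /B; lra.
have t3 : n1 (F b *m (G a - G b - DG x)) <= B * c1 * n1 x.
  apply: le_trans (n1M _ _) _; rewrite -mulrA.
  by apply: ler_pM (n1_ge0 _) (n1_ge0 _) Fb (h2 _ _ a2 b2).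
have t4 : n1 ((F b - F 0) *m DG x) <= B * c1 * n1 x.
  apply: le_trans (n1M _ _) _; rewrite mulrC [leRHS]mulrAC.
  apply: ler_pM (n1_ge0 _) (n1_ge0 _) _ (h3 _ b3).
  by apply: le_trans (hC' _) _; rewrite ler_wpM2r // /B; lra.
apply: le_trans (n1D _ _) _; apply: le_trans (lerD (n1D _ _) t4) _.
apply: le_trans (lerD (lerD (n1D _ _) t3) (lexx _)) _.
apply: le_trans (lerD (lerD (lerD t1 t2) (lexx _)) (lexx _)) _.
rewrite -!mulrDl ler_wpM2r //; apply: le_trans hc.
have : B * c1 <= B * c by rewrite ler_wpM2l.
lra.
Qed.

(** By the group law the increment [x] and the base shift [be] separate into factors: the remainder
    is quadratic in [x], plus [x] times the small error [expm (be *: N) - 1]. *)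
Lemma sdiff_expm (N : 'M[R]_k) (t : R) (l : 'rV[R]_n) :
  sdiff (fun h => expm ((t + (l *m h) 0 0) *: N))
        (fun h => (l *m h) 0 0 *: (N *m expm (t *: N))).
Proof.
pose L := n1 l; pose V := n1 N; pose E := n1 (expm (t *: N)).
have L0 : 0 <= L := n1_ge0 _; have V0 : 0 <= V := n1_ge0 _.
have E0 : 0 <= E := n1_ge0 _.
have hl (h : 'cV[R]_n) : `|(l *m h) 0 0| <= L * n1 h.
  exact: le_trans (le_n1 _ _ _) (n1M _ _).
split.
  exists (L * (V * E)) => [|h]; first by rewrite !mulr_ge0.
  rewrite n1Z mulrAC ler_pM ?n1_ge0 ?hl //; exact: n1M.
move=> e e0.
have [d1 d10 h1] := @small_mul (L * V) (1 / 4) (mulr_ge0 L0 V0) ltac:(lra).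
(* The 10 arises from [4 * n1 (x *: N) + 2 * n1 (be *: N)], where the two norms are at most
   [2 * (L * V * d)] and [L * V * d]. *)
have [d2 d20 h2] := @small_mul (10 * (L * V) * (L * V) * E) e ltac:(by rewrite !mulr_ge0) e0.
exists (Num.min d1 d2) => [|a b]; first by rewrite lt_min d10.
rewrite !le_min => /andP[a1 a2] /andP[b1 b2].
pose d := Num.max (n1 a) (n1 b).
have ad : n1 a <= d by rewrite le_max lexx.
have bd : n1 b <= d by rewrite le_max lexx orbT.
have dd1 : L * V * d <= 1 / 4 by apply: h1; rewrite ge_max a1.
have dd2 : 10 * (L * V) * (L * V) * E * d <= e by apply: h2; rewrite ge_max a2.
set x := (l *m (a - b)) 0 0; set be := (l *m b) 0 0.
have -> : t + (l *m a) 0 0 = (t + be) + x.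
  have -> : x = (l *m a) 0 0 - be by rewrite /x /be mulmxBr mxE [X in _ + X]mxE.
  by ring.
have nd : n1 (a - b) <= 2 * d by apply: le_trans (n1B _ _) _; lra.
have hx : `|x| <= L * n1 (a - b) := hl _.
have hb : `|be| <= L * d by apply: le_trans (hl _) _; rewrite ler_wpM2l.
have hx2 : `|x| <= L * (2 * d) by apply: le_trans hx _; rewrite ler_wpM2l.
have xV : n1 (x *: N) <= 2 * (L * V * d).
  by rewrite n1Z -/V; apply: le_trans (ler_wpM2r V0 hx2) _; lra.
have bV : n1 (be *: N) <= L * V * d.
  by rewrite n1Z -/V; apply: le_trans (ler_wpM2r V0 hb) _; lra.
have q1 : n1 (expm (x *: N) - (1%:M + x *: N)) <= 2 * n1 (x *: N) ^+ 2.
  by apply: n1_expm2; lra.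
have q2 : n1 (expm (be *: N) - 1%:M) <= 2 * n1 (be *: N) by apply: n1_expm1; lra.
have -> : expm ((t + be + x) *: N) - expm ((t + be) *: N) - x *: (N *m expm (t *: N)) =
   (expm (x *: N) - (1%:M + x *: N)) *m (expm (t *: N) + (expm (be *: N) - 1%:M) *m expm (t *: N))
   + x *: N *m ((expm (be *: N) - 1%:M) *m expm (t *: N)).
  have -> : (expm (be *: N) - 1%:M) *m expm (t *: N) = expm ((t + be) *: N) - expm (t *: N).
    by rewrite mulmxBl mul1mx -expmDZ [be + t]addrC.
  rewrite [expm (t *: N) + _]addrC subrK [t + be + x]addrC expmDZ.
  rewrite mulmxBl mulmxDl mulmxBr mul1mx -!scalemxAl.
  by rewrite opprD !addrA subrK.
apply: le_trans (n1D _ _) _; apply: le_trans (lerD (n1M _ _) (n1M _ _)) _.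
have r1 : n1 ((expm (be *: N) - 1%:M) *m expm (t *: N)) <= 2 * n1 (be *: N) * E.
  by apply: le_trans (n1M _ _) _; rewrite ler_wpM2r.
have r2 : n1 (expm (t *: N) + (expm (be *: N) - 1%:M) *m expm (t *: N)) <= 2 * E.
  apply: le_trans (n1D _ _) _; rewrite -/E.
  have : 2 * n1 (be *: N) * E <= 1 * E by rewrite ler_wpM2r //; lra.
  lra.
have s1 := ler_pM (n1_ge0 _) (n1_ge0 _) q1 r2.
have s2 := ler_wpM2l (n1_ge0 (x *: N)) r1.
apply: le_trans (lerD s1 s2) _.
have xN0 := n1_ge0 (x *: N).
have -> : 2 * n1 (x *: N) ^+ 2 * (2 * E) + n1 (x *: N) * (2 * n1 (be *: N) * E) =
  n1 (x *: N) * ((4 * n1 (x *: N) + 2 * n1 (be *: N)) * E) by ring.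
apply: (@le_trans _ _ ((V * L * n1 (a - b)) * (10 * (L * V * d) * E))).
  apply: ler_pM => //.
  - by rewrite !mulr_ge0 // addr_ge0 // mulr_ge0 ?n1_ge0.
  - by rewrite n1Z -/V mulrC -mulrA ler_wpM2l.
  - by rewrite ler_wpM2r //; lra.
have -> : V * L * n1 (a - b) * (10 * (L * V * d) * E) =
  10 * (L * V) * (L * V) * E * d * n1 (a - b) by ring.
by rewrite ler_wpM2r ?n1_ge0.
Qed.

End StrictDifferentiability.

(** * Local reachability through a full word *)

Section LocalReach.
Context {R : realType}.
Variables (m k n : nat) (M : 'cV[R]_m -> 'M[R]_k) (Om : set 'cV[R]_m).
Implicit Types (s : seq ('cV[R]_m * R)) (ss : seq (('cV[R]_m * R) * 'rV[R]_n)).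

(** Each letter carries a row, the functional by which its duration follows [h]. Thus the parameter
    has the dimension of the state, whatever the length of the word. *)
Definition shift_word ss (h : 'cV[R]_n) : seq ('cV[R]_m * R) :=
  [seq (q.1.1, q.1.2 + (q.2 *m h) 0 0) | q <- ss].

Fixpoint tang ss (h : 'cV[R]_n) : 'M[R]_k :=
  if ss is q :: ss' then
    (q.2 *m h) 0 0 *: M q.1.1 + conj_by (expm (q.1.2 *: M q.1.1)) (tang ss' h)
  else 0.

Lemma shift_word0 ss : shift_word ss 0 = map fst ss.
Proof.
by apply: eq_map => -[[w t] l] /=; rewrite mulmx0 mxE addr0.
Qed.

Lemma sdiff_word ss :
  sdiff (fun h => gl M (shift_word ss h)) (fun h => gl M (map fst ss) *m tang ss h).
Proof.
elim: ss => [|q ss IH] /=.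
  have := @sdiff_cst R n k 1%:M.
  by congr sdiff; apply/funext => h; rewrite mulmx0.
have := sdiffM IH (@sdiff_expm R n k (M q.1.1) q.1.2 q.2).
congr sdiff; apply/funext => h; first by rewrite gl_cons.
rewrite mulmx0 mxE addr0 shift_word0 gl_cons /= mulmxDr /conj_by.
set E := expm _; set G := gl _ _.
rewrite -[G *m E *m (_ *m E)]mulmxA (mulmxA E) (mulmxA E) mulmxV ?expm_unit // mul1mx.
rewrite -!scalemxAr -[G *m E *m M _]mulmxA [E *m M _]expmZ_commute !mulmxA.
by rewrite addrC.
Qed.

Lemma tang_zip s ls h : size ls = size s ->
  tang (zip s ls) h =
    \sum_(i < size s) (nth 0 ls i *m h) 0 0 *: nth 0 (dirs M s) i.
Proof.
elim: s ls => [|p s IH] [|l ls] // hs; first by rewrite big_ord0.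
have {}hs : size ls = size s by case: hs.
rewrite big_ord_recl /= IH // linear_sum; congr (_ + _); apply: eq_bigr => i _.
by rewrite linearZ /= (nth_map 0) ?size_dirs ?add0n.
Qed.

Lemma shift_word_admissible ss : admissible Om (map fst ss) ->
  exists2 r, 0 < r & forall h, n1 h <= r -> admissible Om (shift_word ss h).
Proof.
elim: ss => [|[[w t] l] ss IH] ad /=; first by exists 1.
have [|r r0 hr] := IH; first by move=> p hp; apply: ad; rewrite /= inE hp orbT.
have [hw /= t0] := ad (w, t) (mem_head _ _).
have [d d0 hd] := @small_mul R (n1 l) (t / 2) (n1_ge0 _) ltac:(lra).
exists (Num.min r d) => [|h]; first by rewrite lt_min r0.
rewrite le_min => /andP[h1 h2] p; rewrite inE => /orP[/eqP -> /=|]; last exact: hr.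
split=> //; have := hd _ h2; have := le_n1 (l *m h) 0 0; have := n1M l h.
rewrite ler_norml => q1 /andP[q2 _] q3; lra.
Qed.

(** Durations are varied along combinations for which the end state has derivative the identity in
    [h]. The estimates are uniform in the initial state, so both endpoints may move. [Pr] is the
    identity in the homogeneous case and drops the last coordinate in the affine one. *)
Lemma local_reach s (z0 : 'cV[R]_k) (Pr : 'M[R]_(n, k)) :
  admissible Om s -> full M Om s ->
  (forall y : 'cV[R]_n, exists2 Z, liealg [set M w | w in Om] Z &
     Pr *m (Z *m (gl M s *m z0)) = y) ->
  exists2 r, 0 < r & forall z y, n1 (z - z0) < r -> n1 (y - Pr *m (gl M s *m z0)) < r ->
    exists2 s', admissible Om s' & Pr *m (gl M s' *m z) = y.
Proof.
move=> ad fs surj.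
have /choice[Z hZ] : forall j : 'I_n, exists Z,
    liealg [set M w | w in Om] Z /\ Pr *m (Z *m (gl M s *m z0)) = delta_mx j 0.
  by move=> j; have [Z h1 h2] := surj (delta_mx j 0); exists Z.
pose c (j : 'I_n) := coord (in_tuple (dirs M s)) ^~ (conj_by (gl M s) (Z j)).
have hc j : conj_by (gl M s) (Z j) = \sum_i c j i *: (dirs M s)`_i.
  by apply: (@coord_span _ _ _ (in_tuple (dirs M s))); apply: fs; apply: (proj1 (hZ j)).
(* Row [i] collects the [i]-th coefficients of all the [Z j]; with it, moving [h] along the basis
   vector [j] produces the tangent [conj_by (gl M s) (Z j)]. *)
pose ls := [seq (\row_j c j i) | i : 'I_(size (dirs M s))].
have sls : size ls = size s by rewrite size_map size_enum_ord size_dirs.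
pose ss := zip s ls.
have ssE : map fst ss = s.
  by rewrite -[RHS](@unzip1_zip _ _ s ls) ?sls.
have tangE h : Pr *m (gl M s *m (tang ss h *m z0)) = h.
  have -> : tang ss h = \sum_j h j 0 *: conj_by (gl M s) (Z j).
    rewrite tang_zip // -(size_dirs M s).
    under [RHS]eq_bigr => j _.
      rewrite hc scaler_sumr.
      under eq_bigr do rewrite scalerA.
      over.
    rewrite exchange_big; apply: eq_bigr => i _ /=.
    rewrite -scaler_suml; congr (_ *: _).
    rewrite /ls (nth_map i) ?size_enum_ord // nth_ord_enum mxE.
    by apply: eq_bigr => j _; rewrite mxE mulrC.
  rewrite mulmx_suml !mulmx_sumr [RHS](matrix_sum_delta h).
  apply: eq_bigr => j _; rewrite big_ord1 -!scalemxAl -!scalemxAr; congr (_ *: _).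
  by rewrite /conj_by -(proj2 (hZ j)) -!mulmxA (mulmxA (gl M s)) mulmxV ?gl_unit // mul1mx.
have [[C C0 hC] hD] := sdiff_word ss.
rewrite ssE in hC hD.
have [r1 r10 hr1] : exists2 r, 0 < r & forall h, n1 h <= r -> admissible Om (shift_word ss h).
  by apply: shift_word_admissible; rewrite ssE.
have P0 := n1_ge0 Pr; have z00 := n1_ge0 z0.
(* The contraction constant [1 / 2] is shared equally between the error of linearisation and the
   displacement of [z] from [z0]. *)
have [e e0 he] := @small_mul R (n1 Pr * (n1 z0 + 1)) (1 / 4)
  ltac:(by rewrite mulr_ge0 // addr_ge0) ltac:(lra).
have {}he := he e (lexx _).
have [d d0 hd] := hD e e0.
pose r := Num.min r1 d; have r0 : 0 < r by rewrite lt_min r10.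
have rr1 : r <= r1 by rewrite ge_min lexx.
have rd : r <= d by rewrite ge_min lexx orbT.
have [q1 q10 hq1] := @small_mul R (n1 Pr * C) (1 / 4) (mulr_ge0 P0 C0) ltac:(lra).
have [q2 q20 hq2] := @small_mul R (1 + n1 Pr * n1 (gl M s)) (r / 2)
  ltac:(by rewrite addr_ge0 // mulr_ge0 // n1_ge0) ltac:(lra).
pose q := Num.min 1 (Num.min q1 q2).
exists q => [|z y]; first by rewrite !lt_min ltr01 q10.
rewrite /q !lt_min => /and3P[z1 zq1 zq2] /and3P[_ _ yq2].
have nz : n1 z <= n1 z0 + 1.
  by rewrite -(subrK z0 z); apply: le_trans (n1D _ _) _; lra.
have [a [ar fa]] : exists a, n1 a <= r /\ Pr *m (gl M (shift_word ss a) *m z) = y.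
  apply: (@near_id_surj R n (fun a => Pr *m (gl M (shift_word ss a) *m z)) r) => //.
  - move=> a b ha hb.
    have hab := hd a b (le_trans ha rd) (le_trans hb rd).
    set X := _ - _ - _ *m _ in hab.
    have -> : Pr *m (gl M (shift_word ss a) *m z) - Pr *m (gl M (shift_word ss b) *m z) - (a - b)
      = Pr *m (X *m z) + Pr *m ((gl M s *m tang ss (a - b)) *m (z - z0)).
      rewrite -{1}(tangE (a - b)) /X.
      rewrite !(mulmxBl, mulmxBr) -!mulmxA.
      by rewrite addrA subrK.
    apply: le_trans (n1D _ _) _.
    have x0 := n1_ge0 (a - b).
    have t1 : n1 (Pr *m (X *m z)) <= 1 / 4 * n1 (a - b).
      apply: le_trans (n1M _ _) _.
      apply: le_trans (ler_wpM2l P0 (n1M _ _)) _.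
      apply: le_trans (ler_wpM2l P0 (ler_pM (n1_ge0 _) (n1_ge0 _) hab nz)) _.
      rewrite (_ : n1 Pr * _ = n1 Pr * (n1 z0 + 1) * e * n1 (a - b)); last by ring.
      by rewrite ler_wpM2r.
    have t2 : n1 (Pr *m ((gl M s *m tang ss (a - b)) *m (z - z0))) <= 1 / 4 * n1 (a - b).
      apply: le_trans (n1M _ _) _.
      apply: le_trans (ler_wpM2l P0 (n1M _ _)) _.
      apply: le_trans (ler_wpM2l P0 (ler_wpM2r (n1_ge0 _) (hC _))) _.
      rewrite (_ : n1 Pr * _ = n1 Pr * C * n1 (z - z0) * n1 (a - b)); last by ring.
      by rewrite ler_wpM2r // hq1 // ltW.
    lra.
  - rewrite shift_word0 ssE.
    apply: le_trans (n1_dist_trans (Pr *m (gl M s *m z0)) _ _) _.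
    rewrite -mulmxBr -mulmxBr.
    have := n1M Pr (gl M s *m (z0 - z)).
    have := ler_wpM2l P0 (n1M (gl M s) (z0 - z)); rewrite mulrA.
    rewrite [n1 (z0 - z)]n1_distC.
    have G0 : 0 <= n1 Pr * n1 (gl M s) by rewrite mulr_ge0 // n1_ge0.
    have := ler_wpM2l G0 (ltW zq2); have := hq2 q2 (lexx _); lra.
by exists (shift_word ss a) => //; apply: hr1; apply: le_trans ar rr1.
Qed.

End LocalReach.

(** * Orbits, mutual reachability and control sets of a flow *)

Section ControlSets.
Context {R : realType}.
Variables (m k : nat) (F : 'cV[R]_m -> R -> 'cV[R]_k -> 'cV[R]_k) (Om : set 'cV[R]_m).
Implicit Types (x y z : 'cV[R]_k) (s : seq ('cV[R]_m * R)) (X D : set 'cV[R]_k).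

(** Times range over all reals, so that a word can be undone by [inv_word]. *)
Record is_flow : Prop := IsFlow {
  flow0 : forall w x, F w 0 x = x;
  flowD : forall w a b x, F w b (F w a x) = F w (a + b) x;
  flow_cont : forall w t x e, 0 < e -> exists2 d, 0 < d &
    forall y, n1 (y - x) < d -> n1 (F w t y - F w t x) < e }.

Hypothesis flowF : is_flow.

Lemma run_cat s1 s2 x : run F (s1 ++ s2) x = run F s2 (run F s1 x).
Proof. by rewrite /run foldl_cat. Qed.

Lemma run_cont s x e : 0 < e -> exists2 d, 0 < d &
  forall y, n1 (y - x) < d -> n1 (run F s y - run F s x) < e.
Proof.
elim: s x e => [|p s IH] x e e0; first by exists e.
have [d d0 hd] := IH (F p.1 p.2 x) e e0.
have [d' d'0 hd'] := flow_cont flowF p.1 p.2 x d0.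
by exists d' => // y /hd' /hd.
Qed.

Definition inv_word s := rev [seq (p.1, - p.2) | p <- s].

Lemma run_inv_word s x : run F s (run F (inv_word s) x) = x.
Proof.
elim: s x => [|p s IH] x //.
rewrite /inv_word /= rev_cons -cats1 run_cat /= flowD // addNr flow0 //.
Qed.

Lemma inv_word_run s x : run F (inv_word s) (run F s x) = x.
Proof.
elim: s x => [|p s IH] x //.
rewrite /inv_word /= rev_cons -cats1 run_cat [run F (rev _) _]IH /=.
by rewrite flowD // addrN flow0.
Qed.

Lemma orbit_refl x : orbit_pos F Om x x.
Proof. by exists [::]. Qed.

Lemma orbit_trans y x z : orbit_pos F Om x y -> orbit_pos F Om y z -> orbit_pos F Om x z.
Proof.
move=> [s1 [h1 ->]] [s2 [h2 ->]]; exists (s1 ++ s2); split; last by rewrite run_cat.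
by move=> p; rewrite mem_cat => /orP[/h1|/h2].
Qed.

Lemma orbit_run s x : admissible Om s -> orbit_pos F Om x (run F s x).
Proof. by move=> h; exists s; split=> // p /h[? /ltW]. Qed.

(** Orbits permit pieces of duration zero, admissible words do not; such pieces are filtered out. *)
Lemma orbit_admissible x y : orbit_pos F Om x y ->
  exists2 s, admissible Om s & y = run F s x.
Proof.
move=> [s [h ->]]; exists [seq p <- s | 0 < p.2].
  by move=> p; rewrite mem_filter => /andP[p0 /h[]].
elim: s x h => [|p s IH] x h //=.
have h' q : q \in s -> Om q.1 /\ 0 <= q.2 by move=> qs; apply: h; rewrite inE qs orbT.
case: ifPn => [_|]; first exact: IH.
have [_ p0] := h p (mem_head _ _).
rewrite -leNgt => p0'; have -> : p.2 = 0 by apply/eqP; rewrite eq_le p0 p0'.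
by rewrite flow0 //; apply: IH.
Qed.

Lemma closureRP (A : set 'cV[R]_k) y :
  closureR A y <-> forall e, 0 < e -> exists2 a, A a & n1 (y - a) < e.
Proof.
split=> h e e0.
  have [|a Aa ha] := h (e / (k * 1).+1%:R); first by rewrite divr_gt0.
  by exists a => //; apply: n1_le_mxnorm.
have [a Aa ha] := h e e0; exists a => //; exact: le_lt_trans (mxnorm_le_n1 _) ha.
Qed.

Lemma closure_orbit_trans y x z : closureR (orbit_pos F Om x) y ->
  closureR (orbit_pos F Om y) z -> closureR (orbit_pos F Om x) z.
Proof.
move=> /closureRP hy /closureRP hz; apply/closureRP => e e0.
have e2 : 0 < e / 2 by lra.
have [_ [s [hs ->]] h1] := hz _ e2.
have [d d0 hd] := run_cont s y e2.
have [y' oy' hy'] := hy d d0.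
exists (run F s y'); first by apply: orbit_trans oy' _; exists s.
apply: le_lt_trans (n1_dist_trans (run F s y) _ _) _.
have : n1 (run F s y' - run F s y) < e / 2 by apply: hd; rewrite n1_distC.
rewrite n1_distC; lra.
Qed.

Lemma orbit_closure x y : orbit_pos F Om x y -> closureR (orbit_pos F Om x) y.
Proof. by move=> h; apply/closureRP => e e0; exists y => //; rewrite subrr n1_0. Qed.

Definition mutual y : set 'cV[R]_k :=
  [set z | orbit_pos F Om y z /\ orbit_pos F Om z y].

Lemma mutual_sym x y : mutual x y -> mutual y x.
Proof. by case. Qed.

Lemma mutual_trans x y z : mutual x y -> mutual y z -> mutual x z.
Proof.
by move=> [a b] [c d]; split; [exact: orbit_trans a c|exact: orbit_trans d b].
Qed.

Lemma durations_ge s : admissible Om s ->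
  exists2 c, 0 < c & forall p, p \in s -> c <= p.2.
Proof.
elim: s => [|p s IH] h; first by exists 1.
have [|c c0 hc] := IH; first by move=> q qs; apply: h; rewrite inE qs orbT.
have [_ p0] := h p (mem_head _ _).
exists (Num.min c p.2) => [|q]; first by rewrite lt_min c0.
by rewrite inE => /orP[/eqP ->|/hc qc]; rewrite ge_min ?lexx ?orbT // qc.
Qed.

(** The loop is repeated forever. A point inside it is reached from [z] by the part already run and
    returns to [z] by the rest; switching times do not accumulate because the finitely many
    durations have a positive lower bound. *)
Lemma loop_can_stay D s z : s != [::] -> admissible Om s -> run F s z = z ->
  (forall y, mutual z y -> D y) -> can_stay F Om D z.
Proof.
move=> s0 ad sz hD; set N := size s.
have N0 : (0 < N)%N by rewrite /N; case: (s) s0.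
pose p0 : 'cV[R]_m * R := (0, 0).
pose pc (j : nat) := nth p0 s (j %% N).
have pcs j : pc j \in s by rewrite mem_nth // ltn_pmod.
pose w (j : nat) := (pc j).1; pose tau (j : nat) := (pc j).2.
have takeS i : (i < N)%N -> run F (take i.+1 s) z =
    F (nth p0 s i).1 (nth p0 s i).2 (run F (take i s) z).
  by move=> iN; rewrite (take_nth p0) // -cats1 run_cat.
have stE j : stateN F w tau z j = run F (take (j %% N) s) z.
  elim: j => [|j IH]; first by rewrite mod0n take0.
  rewrite /= IH -takeS ?ltn_pmod //.
  have -> : (j.+1 %% N = (j %% N).+1 %% N)%N by rewrite -[in LHS]addn1 -[in RHS]addn1 modnDml.
  have := ltn_pmod j N0; rewrite leq_eqVlt => /orP[/eqP ->|h].
    by rewrite modnn take0 take_size.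
  by rewrite (modn_small h).
have [c c0 hc] := durations_ge ad.
exists w, tau; split.
- by move=> j; have [] := ad _ (pcs j).
- by move=> j; have [] := ad _ (pcs j).
- move=> T; have [n hn] : exists n : nat, T <= n%:R * c.
    exists (Num.truncn `|T / c|).+1; rewrite -ler_pdivrMr //.
    by apply: le_trans (ler_norm _) _; rewrite ltW // truncnS_gt.
  exists n; apply: le_trans hn _; rewrite mulr_natl -[X in c *+ X]card_ord -sumr_const.
  by apply: ler_sum => j _; apply: hc.
- move=> j u /andP[u0 utau]; apply: hD; rewrite stE; set i := (j %% N)%N.
  have iN : (i < N)%N by apply: ltn_pmod.
  have pos p : p \in s -> Om p.1 /\ 0 <= p.2 by move=> /ad[? /ltW].
  have [Omj _] := pos _ (pcs j).
  split.
    exists (take i s ++ [:: (w j, u)]); split; last by rewrite run_cat.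
    move=> p; rewrite mem_cat inE => /orP[/mem_take/pos//|/eqP ->].
    by split.
  exists ((w j, tau j - u) :: drop i.+1 s); split.
    move=> p; rewrite inE => /orP[/eqP ->|/mem_drop/pos//].
    by split=> //=; rewrite subr_ge0.
  rewrite /= -[run F _ _]/(run F (drop i.+1 s) _) flowD //.
  by rewrite [u + _]addrC subrK -takeS // -run_cat cat_take_drop sz.
Qed.

(** From [z] one goes to [y], runs the loop and returns; the nonempty [s] guarantees positive
    duration even when [z = y]. *)
Lemma mutual_ctrl_pre X y s : s != [::] -> admissible Om s -> run F s y = y ->
  (forall z, orbit_pos F Om y z -> X z) -> ctrl_pre F Om X (mutual y).
Proof.
move=> s0 ad sy hX; split.
- by move=> z [/hX].
- by exists y; split; apply: orbit_refl.
- move=> z myz; have [oyz ozy] := myz.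
  have [b adb zE] := orbit_admissible oyz; have [a ada yE] := orbit_admissible ozy.
  apply: (@loop_can_stay _ (a ++ s ++ b)).
  + by case: (a) => //; case: (s) s0.
  + by do 2 apply: admissible_cat => //.
  + by rewrite !run_cat -yE sy.
  + by move=> z'; apply: mutual_trans.
- move=> z [_ ozy] z' [oyz' _]; apply: orbit_closure; exact: orbit_trans ozy oyz'.
Qed.

(** Approximate reachability between different members passes through the common point [y]. The
    union of all candidates through [y] is therefore the control set, without Zorn's lemma. *)
Lemma bigcup_ctrl_pre X y (FF : set (set 'cV[R]_k)) : FF !=set0 ->
  (forall D, FF D -> ctrl_pre F Om X D /\ D y) ->
  ctrl_pre F Om X (\bigcup_(D in FF) D).
Proof.
move=> [D0 FD0] h; split.
- by move=> z [D FD Dz]; have [[DX _ _ _] _] := h _ FD; apply: DX.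
- by exists y; exists D0 => //; have [] := h _ FD0.
- move=> z [D FD Dz]; have [[_ _ st _] _] := h _ FD.
  have [w [tau [h1 h2 h3 h4]]] := st z Dz.
  by exists w, tau; split=> // j u uj; exists D => //; apply: h4.
- move=> z [D FD Dz] z' [D' FD' Dz'].
  have [[_ _ _ c] Dy] := h _ FD; have [[_ _ _ c'] Dy'] := h _ FD'.
  exact: closure_orbit_trans (c z Dz y Dy) (c' y Dy' z' Dz').
Qed.

Lemma control_set_exists X D0 y : ctrl_pre F Om X D0 -> D0 y ->
  exists2 D, control_set F Om X D & D0 `<=` D.
Proof.
move=> pD0 D0y; pose FF := [set D | ctrl_pre F Om X D /\ D y].
have hF : FF !=set0 by exists D0.
exists (\bigcup_(D in FF) D); last by move=> z D0z; exists D0.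
split; first by exact: (bigcup_ctrl_pre hF (fun D h => h)).
move=> D' pD' sub; apply/seteqP; split=> // z D'z; exists D' => //; split=> //.
by apply: sub; exists D0.
Qed.

Lemma control_set_sub X D0 D y : control_set F Om X D -> D y ->
  ctrl_pre F Om X D0 -> D0 y -> D0 `<=` D.
Proof.
move=> [pD maxD] Dy pD0 D0y.
have pU : ctrl_pre F Om X (\bigcup_(E in [set D; D0]) E).
  by apply: (@bigcup_ctrl_pre _ y); [exists D; left|move=> E [->|->]].
have <- : \bigcup_(E in [set D; D0]) E = D.
  by apply: maxD => // z Dz; exists D => //; left.
by move=> z D0z; exists D0 => //; right.
Qed.

Definition locally_mutual y := exists2 r, 0 < r &
  forall z z', n1 (z - y) < r -> n1 (z' - y) < r -> orbit_pos F Om z z'.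

(** The open middle piece absorbs both perturbations: [z] is pushed forward along [pre], and the
    target for the middle piece is [z'] pulled back along [post]. The pull-back only selects a
    point; the motion itself stays forward in time. *)
Lemma loop_locally_mutual pre s post y :
  admissible Om pre -> admissible Om post ->
  run F (pre ++ s ++ post) y = y ->
  (exists2 r, 0 < r & forall z z', n1 (z - run F pre y) < r ->
     n1 (z' - run F s (run F pre y)) < r -> orbit_pos F Om z z') ->
  locally_mutual y.
Proof.
move=> ad1 ad2 loop [r r0 hr].
have [d1 d10 h1] := run_cont pre y r0.
have [d2 d20 h2] := run_cont (inv_word post) y r0.
exists (Num.min d1 d2) => [|z z']; first by rewrite lt_min d10.
rewrite !lt_min => /andP[z1 _] /andP[_ z2].
apply: orbit_trans (orbit_run z ad1) _.
rewrite -(run_inv_word post z'); apply: orbit_trans (orbit_run _ ad2).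
apply: hr; first exact: h1.
suff <- : run F (inv_word post) y = run F s (run F pre y) by apply: h2.
by rewrite -{1}loop !run_cat inv_word_run.
Qed.

Lemma locally_mutual_line (y v : 'cV[R]_k) :
  (forall c, locally_mutual (y + c *: v)) -> forall c, mutual y (y + c *: v).
Proof.
move=> h.
have H (u : 'cV[R]_k) : (forall c, locally_mutual (y + c *: u)) ->
    forall c, 0 <= c -> mutual y (y + c *: u).
  move=> hu c c0.
  suff : mutual (y + 0 *: u) (y + c *: u) by rewrite scale0r addr0.
  apply: (@equiv_open_line R (fun a b => mutual (y + a *: u) (y + b *: u))) => //.
  - by move=> a; split; apply: orbit_refl.
  - by move=> a b; apply: mutual_sym.
  - by move=> a b d; apply: mutual_trans.
  - move=> a; have [r r0 hr] := hu a.
    have [d d0 hd] := @small_mul R (n1 u) (r / 2) (n1_ge0 _) ltac:(lra).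
    exists d => // b ab.
    have hb : n1 (y + b *: u - (y + a *: u)) < r.
      rewrite opprD addrACA subrr add0r -scalerBl n1Z mulrC.
      by have := hd _ (ltW ab); lra.
    by split; apply: hr => //; rewrite subrr n1_0.
move=> c; case: (leP 0 c) => c0; first exact: H.
rewrite -[c]opprK scaleNr -scalerN; apply: H; last by rewrite oppr_ge0 ltW.
by move=> a; rewrite scalerN -scaleNr.
Qed.

End ControlSets.

(** * The affine system in homogeneous coordinates *)

Section AffineSystem.
Context {R : realType}.
Variables (n m : nat).
Variables (A : 'M[R]_n) (B : 'I_m -> 'M[R]_n) (C : 'M[R]_(n, m)) (d : 'cV[R]_n).
Variable Om : set 'cV[R]_m.
Implicit Types (s : seq ('cV[R]_m * R)) (w : 'cV[R]_m).

Local Notation Au := (Au A B).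
Local Notation Mhat := (Mhat A B C d).
Local Notation Fhom := (Fhom A B).
Local Notation Faff := (Faff A B C d).
Local Notation Phi := (Phi A B).
Local Notation gel := (gel A B C d).

Lemma expr_block (a : 'M[R]_n) (b : 'M[R]_(n, 1)) l :
  block_mx a b 0 0 ^+ l.+1 = block_mx (a ^+ l.+1) (a ^+ l *m b) 0 0 :> 'M[R]_(n + 1).
Proof.
elim: l => [|l IH]; first by rewrite !expr1 expr0 mul1mx.
rewrite exprS IH [LHS](mulmx_block a) !(mul0mx, mulmx0, addr0, add0r).
by congr block_mx; rewrite mulmxA [in RHS]exprS.
Qed.

(** Positive powers have zero bottom row, so the bottom row of every nonempty partial sum, and of
    the limit, is that of the identity. The corner [b'] stays implicit; only its existence is
    used. *)
Lemma expm_block (a : 'M[R]_n) (b : 'M[R]_(n, 1)) :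
  exists b', expm (block_mx a b 0 0 : 'M[R]_(n + 1)) = block_mx (expm a) b' 0 1%:M.
Proof.
set N : 'M[R]_(n + 1) := block_mx _ _ _ _; exists (ursubmx (expm N)).
have low (i : 'I_1) j : expm N (rshift n i) j = 1%:M (rshift n i) j.
  apply/eqP; rewrite -subr_eq0 -normr_le0; apply/ler_addgt0Pl => e e0; rewrite addr0.
  have [N0 H] := expm_psum_lim N e0; have := H N0.+1 (leqnSn _).
  rewrite n1_distC => /ltW h; apply: le_trans h; apply: le_trans (le_n1 _ (rshift n i) j).
  suff -> : expm_psum N N0.+1 = 1%:M + \sum_(l < N0) (l.+1`!%:R)^-1 *: N ^+ l.+1.
    rewrite !mxE opprD addrA -[X in _ <= `|X|]addr0.
    rewrite summxE big1 ?oppr0 ?addr0 //= => l _.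
    rewrite mxE expr_block.
    by rewrite block_mxEv (col_mxEd (row_mx _ _)) row_mx0 mxE mulr0.
  by rewrite /expm_psum big_ord_recl expr0 fact0 invr1 scale1r.
rewrite -[LHS](@submxK R n 1 n 1 (expm N)); congr block_mx.
- apply/matrixP => i j; rewrite !mxE; congr (limn _); apply/funext => N0.
  apply: eq_bigr => -[[|l] hl] _ //=; congr (_ * _).
    by rewrite !expr0 !mxE.
  by rewrite expr_block block_mxEul.
- apply/matrixP => i j; rewrite [LHS]mxE [LHS]mxE low !mxE.
  by rewrite eq_rlshift.
- apply/matrixP => i j; rewrite [LHS]mxE [LHS]mxE low !mxE.
  by rewrite eq_rshift.
Qed.

Lemma gel_block s : exists b, gel s = block_mx (Phi s) b 0 1%:M.
Proof.
elim/last_ind: s => [|s p [b IH]].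
  by exists 0; rewrite /Defs.gel /Defs.Phi /= -scalar_mx_block.
have [b' E] := expm_block (p.2 *: Au p.1) (p.2 *: (C *m p.1 + d)).
exists (expm (p.2 *: Au p.1) *m b + b').
rewrite /Defs.gel /Defs.Phi -cats1 !foldl_cat /= -/(gel s) -/(Phi s) IH.
have -> : p.2 *: Mhat p.1 = block_mx (p.2 *: Au p.1) (p.2 *: (C *m p.1 + d)) 0 0.
  by rewrite /Defs.Mhat scale_block_mx !scaler0.
by rewrite E mulmx_block !(mul0mx, mulmx0, addr0, add0r, mulmx1, mul1mx).
Qed.

Lemma gel_col s (x y : 'cV[R]_n) c : usubmx (gel s *m col_mx x c) = y ->
  gel s *m col_mx x c = col_mx y c.
Proof.
have [b ->] := gel_block s; rewrite mul_block_col col_mxKu => ->.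
by rewrite mul0mx mul1mx add0r.
Qed.

Lemma gel_col0 s (x : 'cV[R]_n) : gel s *m col_mx x 0 = col_mx (Phi s *m x) 0.
Proof.
by have [b ->] := gel_block s; rewrite mul_block_col !mulmx0 mul0mx !addr0.
Qed.

Lemma Faff_col w t (x : 'cV[R]_n) :
  col_mx (Faff w t x) 1 = expm (t *: Mhat w) *m col_mx x 1.
Proof.
have := @gel_col [:: (w, t)] x _ 1 erefl.
by rewrite /Defs.gel /= mulmx1 => ->.
Qed.

Lemma run_aff s (x : 'cV[R]_n) : col_mx (run Faff s x) 1 = gel s *m col_mx x 1.
Proof.
elim/last_ind: s => [|s p IH]; first by rewrite /Defs.gel /= mul1mx.
rewrite -cats1 run_cat /= Faff_col IH mulmxA; congr (_ *m _).
by rewrite /Defs.gel foldl_cat.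
Qed.

Lemma run_hom s (x : 'cV[R]_n) : run Fhom s x = Phi s *m x.
Proof.
elim/last_ind: s => [|s p IH]; first by rewrite /Defs.Phi /= mul1mx.
by rewrite -cats1 run_cat /= /Defs.Fhom IH mulmxA /Defs.Phi foldl_cat.
Qed.

Lemma mulmx_cont p q r (X : 'M[R]_(p, q)) e : 0 < e ->
  exists2 d, 0 < d & forall v : 'M[R]_(q, r), n1 v < d -> n1 (X *m v) < e.
Proof.
move=> e0; have [r0 r00 hr] := @small_mul R (n1 X) (e / 2) (n1_ge0 _) ltac:(lra).
exists r0 => // v /ltW vr; apply: le_lt_trans (n1M _ _) _; have := hr _ vr; lra.
Qed.

Lemma Fhom_flow : is_flow Fhom.
Proof.
split=> [w x|w a b x|w t x e e0]; rewrite /Defs.Fhom.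
- by rewrite scale0r expm0 mul1mx.
- by rewrite mulmxA -expmDZ addrC.
- have [r r0 hr] := @mulmx_cont _ _ 1 (expm (t *: Au w)) _ e0.
  by exists r => // y /hr; rewrite mulmxBr.
Qed.

Definition proj_aff : 'M[R]_(n, n + 1) := row_mx 1%:M 0.

Lemma proj_affE (v : 'cV[R]_(n + 1)) : proj_aff *m v = usubmx v.
Proof. by rewrite -{1}(vsubmxK v) mul_row_col mul1mx mul0mx addr0. Qed.

Lemma n1_col p q (x : 'cV[R]_p) (y : 'cV[R]_q) : n1 (col_mx x y) = n1 x + n1 y.
Proof.
rewrite /n1 big_split_ord /=; congr (_ + _); apply: eq_bigr => i _;
  by apply: eq_bigr => j _; rewrite ?col_mxEu ?col_mxEd.
Qed.

Lemma col_mx1B (x y : 'cV[R]_n) : col_mx x 1 - col_mx y 1 = col_mx (x - y) (0 : 'cV[R]_1).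
Proof. by rewrite opp_col_mx add_col_mx subrr. Qed.

Lemma Faff_flow : is_flow Faff.
Proof.
split=> [w x|w a b x|w t x e e0].
- by rewrite /Defs.Faff scale0r expm0 mul1mx col_mxKu.
- by rewrite {1}/Defs.Faff Faff_col mulmxA -expmDZ addrC.
- rewrite /Defs.Faff.
  have [r r0 hr] := @mulmx_cont _ _ 1 (proj_aff *m expm (t *: Mhat w)) _ e0.
  exists r => // y hy; rewrite -!proj_affE !mulmxA -mulmxBr; apply: hr.
  by rewrite col_mx1B n1_col n1_0 addr0.
Qed.

Lemma aff_local_reach s : ARC_aff A B C d Om -> admissible Om s -> full Mhat Om s ->
  forall x, exists2 r, 0 < r & forall z z', n1 (z - x) < r -> n1 (z' - run Faff s x) < r ->
    orbit_pos Faff Om z z'.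
Proof.
move=> arc ad fs x.
have [|r r0 hr] := @local_reach R m _ n Mhat Om s (col_mx x 1) proj_aff ad fs.
  move=> y; have [Z LZ ZE] := arc (run Faff s x) y; exists Z => //.
  by rewrite proj_affE -[gl _ _]/(gel s) -run_aff.
exists r => // z z' hz hz'.
have [||s' ad' s'E] := hr (col_mx z 1) z'.
- by rewrite col_mx1B n1_col n1_0 addr0.
- by rewrite -[gl _ _]/(gel s) -run_aff proj_affE col_mxKu.
have <- : run Faff s' z = z'.
  by rewrite -s'E -[gl _ _]/(gel s') -run_aff proj_affE col_mxKu.
exact: orbit_run.
Qed.

Lemma hom_local_reach s (x : 'cV[R]_n) : ARC_hom A B Om -> admissible Om s ->
  full Au Om s -> x != 0 ->
  exists2 r, 0 < r & forall z z', n1 (z - x) < r -> n1 (z' - Phi s *m x) < r ->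
    exists2 s', admissible Om s' & Phi s' *m z = z'.
Proof.
move=> arc ad fs x0.
have [|r r0 hr] := @local_reach R m _ n Au Om s x 1%:M ad fs.
  move=> y; have x1 : gl Au s *m x != 0.
    apply: contraNneq x0 => h.
    by rewrite -[x](mulKmx (gl_unit Au s)) h mulmx0.
  by have [Z LZ ZE] := arc _ x1 y; exists Z => //; rewrite mul1mx.
exists r => // z z' hz hz'; have [||s' ad' s'E] := hr z z' => //.
  by rewrite mul1mx.
by exists s' => //; rewrite -s'E mul1mx.
Qed.

Lemma aff_locally_mutual pre s post (y : 'cV[R]_n) : ARC_aff A B C d Om ->
  admissible Om pre -> admissible Om s -> admissible Om post -> full Mhat Om s ->
  run Faff (pre ++ s ++ post) y = y -> locally_mutual Faff Om y.
Proof.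
move=> arc a1 a2 a3 fs loop.
by apply: (loop_locally_mutual Faff_flow a1 a3 loop); apply: aff_local_reach.
Qed.

Lemma Phi_unit s : Phi s \in unitmx.
Proof. exact: gl_unit. Qed.

Lemma Phi_neq0 s (x : 'cV[R]_n) : x != 0 -> Phi s *m x != 0.
Proof.
by apply: contraNneq => h; rewrite -[x](mulKmx (Phi_unit s)) h mulmx0.
Qed.

Lemma hom_locally_mutual pre s post (y : 'cV[R]_n) : ARC_hom A B Om ->
  admissible Om pre -> admissible Om s -> admissible Om post -> full Au Om s ->
  y != 0 -> run Fhom (pre ++ s ++ post) y = y -> locally_mutual Fhom Om y.
Proof.
move=> arc a1 a2 a3 fs y0 loop.
apply: (loop_locally_mutual Fhom_flow a1 a3 loop).
have [|r r0 hr] := @hom_local_reach s (run Fhom pre y) arc a2 fs.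
  by rewrite run_hom Phi_neq0.
exists r => // z z' hz hz'; have [||s' ad' <-] := hr z z' => //; first by rewrite -run_hom.
by rewrite -run_hom; apply: orbit_run.
Qed.

Lemma aff_control_set s (y : 'cV[R]_n) : s != [::] -> admissible Om s ->
  run Faff s y = y -> locally_mutual Faff Om y ->
  exists D, [/\ control_set Faff Om setT D, has_interior D & mutual Faff Om y `<=` D].
Proof.
move=> s0 ad loop [r r0 hr].
have pre := @mutual_ctrl_pre R m n Faff Om Faff_flow setT y s s0 ad loop (fun _ _ => I).
have yy : mutual Faff Om y y by split; apply: orbit_refl.
have [D cD sub] := control_set_exists Faff_flow pre yy.
exists D; split=> //; exists y; exists (r / (n * 1).+1%:R); first by rewrite divr_gt0.
move=> z /(n1_le_mxnorm r0) hz; apply: sub.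
by split; apply: hr => //; rewrite subrr n1_0.
Qed.

(** Vectors of [embedP D] have nonzero last coordinate, so [col_mx x 0] is not even a member, let
    alone interior; being in the closure suffices. *)
Lemma boundary_at_infinity (D : set 'cV[R]_n) (x : 'cV[R]_n) : x != 0 ->
  (forall e, 0 < e -> exists y c, [/\ D y, c != 0 &
     n1 (col_mx x 0 - c *: col_mx y (1 : 'cV[R]_1)) < e]) ->
  boundaryP (embedP D) (col_mx x 0).
Proof.
move=> x0 h.
have one0 : (1 : 'cV[R]_1) != 0 by exact: oner_neq0.
have cx0 : col_mx x (0 : 'cV[R]_1) != 0.
  by apply: contraNneq x0; rewrite -col_mx0 => /eq_col_mx[-> _].
split.
  split=> // e e0; have [y [c [Dy c0 hc]]] := h e e0.
  exists (col_mx y 1); split.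
    by exists y; split=> //; exists 1; rewrite ?oner_neq0 // scale1r.
  split.
    by apply: contraNneq one0; rewrite -col_mx0 => /eq_col_mx[_ ->].
  by exists c => //; apply: le_lt_trans (mxnorm_le_n1 _) hc.
move=> [_ [e e0 sub]].
have [y [_ [c c0]]] : embedP D (col_mx x 0).
  apply: sub; split=> //; exists 1; first exact: oner_neq0.
  by apply: le_lt_trans (mxnorm_le_n1 _) _; rewrite scale1r subrr n1_0.
rewrite scale_col_mx => /eq_col_mx[_ /esym/eqP].
by rewrite scaler_eq0 (negPf c0) (negPf one0).
Qed.

Lemma Au_bounded : (exists K : R, forall w, Om w -> mxnorm w <= K) ->
  exists2 K, 0 <= K & forall w, Om w -> n1 (Au w) <= K.
Proof.
move=> [K hK]; pose L := n1 A + \sum_i `|K| * n1 (B i).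
have s0 : 0 <= \sum_i `|K| * n1 (B i).
  by apply: sumr_ge0 => i _; rewrite mulr_ge0 ?n1_ge0.
exists L => [|w /hK hw]; first by rewrite addr_ge0 ?n1_ge0.
apply: le_trans (n1D _ _) _; rewrite lerD2l; apply: le_trans (n1_sum _ _ _) _.
apply: ler_sum => i _; rewrite n1Z ler_wpM2r ?n1_ge0 //.
by apply: le_trans (entry_le_mxnorm _ _ _) (le_trans hw (ler_norm _)).
Qed.

(** Bounded controls give one growth rate for all words, so closeness to the identity depends on the
    total time alone. *)
Lemma Phi_near1 : (exists K : R, forall w, Om w -> mxnorm w <= K) ->
  forall e, 0 < e -> exists2 r, 0 < r & forall s, admissible Om s ->
    total_time s < r -> n1 (Phi s - 1%:M) <= e.
Proof.
move=> /Au_bounded[K K0 hK] e e0.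
pose f := Num.min e 1; have f0 : 0 < f by rewrite lt_min e0 ltr01.
have [r r0 hr] := @small_mul R (4 * K) f (mulr_ge0 (ler0n _ _) K0) f0.
exists r => // s ad /ltW /hr; rewrite le_min => /andP[h1 h2].
exact: le_trans (gl_near1 K0 hK ad h2) h1.
Qed.

Definition scale_word (c : R) s := [seq (p.1, c * p.2) | p <- s].

Lemma scale_word_admissible c s : 0 < c -> admissible Om s -> admissible Om (scale_word c s).
Proof.
by move=> c0 ad _ /mapP[p /ad[h1 h2] ->]; split=> //=; rewrite mulr_gt0.
Qed.

Lemma scale_word1 s : scale_word 1 s = s.
Proof. by rewrite -[RHS]map_id; apply: eq_map => -[w t]; rewrite /= mul1r. Qed.

Lemma gl_scale_word0 k (M : 'cV[R]_m -> 'M[R]_k) s : gl M (scale_word 0 s) = 1%:M.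
Proof.
by elim: s => [|p s IH] //; rewrite gl_cons [gl _ _]IH mul0r scale0r expm0 mul1mx.
Qed.

Lemma exppoly_scale_word k (M : 'cV[R]_m -> 'M[R]_k) a b s :
  exppoly_mx (fun t => gl M (scale_word (a + b * t) s)).
Proof.
elim: s => [|p s IH]; first exact: exppoly_mx_cst.
have := exppoly_mxM IH (exppoly_expm (p.2 *: M p.1) a b).
by congr exppoly_mx; apply/funext => t; rewrite /= gl_cons /= scalerA.
Qed.

Lemma exppoly_mx_near p q (F : R -> 'M[R]_(p, q)) : exppoly_mx F ->
  forall e, 0 < e -> exists2 r, 0 < r & forall t, `|t| < r -> n1 (F t - F 0) < e.
Proof.
move=> hF e e0; have e'0 : 0 < e / (p * q).+1%:R by rewrite divr_gt0.
have : \forall t \near (0 : R), forall ij : 'I_p * 'I_q,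
   `|F t ij.1 ij.2 - F 0 ij.1 ij.2| < e / (p * q).+1%:R.
  apply: (@filter_forall _ _ (fun ij t => _) (nbhs (0 : R)) _) => -[i j] /=.
  have cF : continuous (fun t => F t i j) := exppoly_continuous (hF i j).
  by have /cvgr_distC_lt/(_ _ e'0) := cF (0 : R).
move=> /nbhs_ballP[r /= r0 hr]; exists r => // t ht; apply: n1_sum_lt => // i j.
rewrite !mxE; apply: (hr t _ (i, j)).
by rewrite /ball /= sub0r normrN.
Qed.

End AffineSystem.

(** * Loops, their deformation and limits of fixed points *)

Section ControlSetsAtInfinity.
Context {R : realType}.
Variables (n m : nat).
Variables (A : 'M[R]_n) (B : 'I_m -> 'M[R]_n) (C : 'M[R]_(n, m)) (d : 'cV[R]_n).
Variable Om : set 'cV[R]_m.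
Implicit Types (s : seq ('cV[R]_m * R)) (w : 'cV[R]_m).

Local Notation Au := (Au A B).
Local Notation Mhat := (Mhat A B C d).
Local Notation Fhom := (Fhom A B).
Local Notation Faff := (Faff A B C d).
Local Notation Phi := (Phi A B).
Local Notation gel := (gel A B C d).

Hypothesis Om_bounded : exists K : R, forall w, Om w -> mxnorm w <= K.
Hypothesis Om0 : Om 0.
Hypothesis arc_aff : ARC_aff A B C d Om.
Hypothesis arc_hom : ARC_hom A B Om.

Lemma Phi_cat s1 s2 : Phi (s1 ++ s2) = Phi s2 *m Phi s1.
Proof. exact: (gl_cat Au). Qed.

Lemma gel_cat s1 s2 : gel (s1 ++ s2) = gel s2 *m gel s1.
Proof. exact: (gl_cat Mhat). Qed.

(** Factor [1 - P] out on the right; what remains is the identity minus a matrix of norm at most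
    [1 / 2]. *)
Lemma perturb_unit (P E : 'M[R]_n) e : 1%:M - P \in unitmx ->
  n1 (E - 1%:M) <= e -> n1 (P *m invmx (1%:M - P)) * e <= 1 / 2 ->
  1%:M - E *m P \in unitmx.
Proof.
move=> uP hE he.
have -> : 1%:M - E *m P =
    (1%:M - (E - 1%:M) *m (P *m invmx (1%:M - P))) *m (1%:M - P).
  rewrite [RHS]mulmxBl mul1mx -!mulmxA mulVmx // mulmx1 mulmxBl mul1mx opprB.
  by rewrite addrA subrK.
rewrite unitmx_mul uP andbT; apply: n1_lt1_unit.
apply: le_lt_trans (n1M _ _) _.
have := ler_wpM2r (n1_ge0 (P *m invmx (1%:M - P))) hE; lra.
Qed.

(** A control set offers only approximate return. Let [z] be the point that the short word
    [sh ++ sa ++ sh] carries to [x0]; it is close enough to [x0] to lie in [RD], so some [z'] near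
    [z] is reachable from [x0]. The first [sh] is then traded for a word leading from [z'] exactly
    to [Phi sh *m z], and [sa ++ sh] closes the loop. *)
Lemma hom_loop s (RD : set 'cV[R]_n) : 1%:M - Phi s \in unitmx ->
  control_set Fhom Om [set x | x != 0] RD -> has_interior RD ->
  exists x0 rho sa sh, [/\ RD x0, x0 != 0,
    [/\ admissible Om rho, admissible Om sa, admissible Om sh, sa != [::] & sh != [::]],
    full Mhat Om sa /\ full Au Om sh &
    Phi (rho ++ sa ++ sh) *m x0 = x0 /\ 1%:M - Phi sa *m Phi s \in unitmx].
Proof.
move=> us cRD [x0 [e e0 ball]].
have [[RDX _ _ RDcl] _] := cRD.
have RDx0 : RD x0 by apply: ball; apply: le_lt_trans (mxnorm_le_n1 _) _; rewrite subrr n1_0.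
have x00 : x0 != 0 := RDX _ RDx0.
have [f1 f10 hf1] := @small_mul R (n1 (Phi s *m invmx (1%:M - Phi s))) (1 / 2)
  (n1_ge0 _) ltac:(lra).
have [f2 f20 hf2] := @small_mul R (2 * n1 x0) (e / 2)
  ltac:(by rewrite mulr_ge0 ?n1_ge0) ltac:(lra).
(* The three bounds give, in turn, [n1 z <= 2 * n1 x0], the invertibility of [1 - Phi sa *m Phi s],
   and [z] inside the ball contained in [RD]. *)
pose f := Num.min (1 / 2) (Num.min f1 f2).
have f0 : 0 < f by rewrite !lt_min f10 f20 andbT; lra.
have f12 : f <= 1 / 2 by rewrite ge_min lexx.
have ff1 : f <= f1 by rewrite !ge_min lexx !orbT.
have ff2 : f <= f2 by rewrite !ge_min lexx !orbT.
have [r r0 hr] := Phi_near1 A B Om_bounded f0.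
(* The word [sg] consists of three short pieces. *)
have r3 : 0 < r / 3 by lra.
have [sa [saN ada sat fsa]] := full_exists Mhat Om0 r3.
have [sh [shN adh sht fsh]] := full_exists Au Om0 r3.
have hsa : n1 (Phi sa - 1%:M) <= f by apply: hr => //; lra.
pose sg := sh ++ sa ++ sh.
have hsg : n1 (Phi sg - 1%:M) <= f.
  by apply: hr; [do 2 apply: admissible_cat => //|rewrite !total_time_cat; lra].
pose z := invmx (Phi sg) *m x0.
have zE : Phi sg *m z = x0 by rewrite mulKVmx // Phi_unit.
have zx0 : n1 (z - x0) <= f * n1 z.
  rewrite n1_distC -{1}zE -{2}[z]mul1mx -mulmxBl; apply: le_trans (n1M _ _) _.
  by rewrite ler_wpM2r ?n1_ge0.
have z2 : n1 z <= 2 * n1 x0.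
  have := n1D (z - x0) x0; rewrite subrK.
  have := ler_wpM2r (n1_ge0 z) f12; lra.
have RDz : RD z.
  apply: ball; apply: le_lt_trans (mxnorm_le_n1 _) _.
  have := ler_wpM2l (ltW f0) z2; have := hf2 f ff2; lra.
have z0 : z != 0 := RDX _ RDz.
have [q q0 hq] := hom_local_reach arc_hom adh fsh z0.
have /closureRP/(_ q q0)[z' oz' hz'] := RDcl _ RDx0 _ RDz.
have [rho0 adrho z'E] := orbit_admissible (Fhom_flow A B) oz'.
have [||s' ads' s'E] := hq z' (Phi sh *m z); first by rewrite n1_distC.
  by rewrite subrr n1_0.
exists x0, (rho0 ++ s'), sa, sh; split=> //.
  by split=> //; apply: admissible_cat.
split; last by apply: (perturb_unit us hsa); apply: hf1.
rewrite run_hom in z'E.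
by rewrite !Phi_cat -!mulmxA -z'E s'E -zE /sg !Phi_cat -!mulmxA.
Qed.

Lemma hom_fixed_mem (RD PD : set 'cV[R]_n) x0 rho sh v :
  control_set Fhom Om [set x | x != 0] RD -> cone PD -> RD `<=` PD ->
  RD x0 -> x0 != 0 -> admissible Om rho -> admissible Om sh -> sh != [::] ->
  full Au Om sh -> Phi (rho ++ sh) *m x0 = x0 ->
  v != 0 -> Phi (rho ++ sh) *m v = v -> PD v.
Proof.
move=> cRD [_ conePD] sub RDx0 x00 adr adh shN fsh fx0 v0 fv.
(* For a negative multiple of [x0] the segment to [v] would cross 0; the scale invariance of [PD]
   settles the whole dependent case. Otherwise [v] even lies in [RD]. *)
have [[c vE]|ndep] := pselect (exists c, v = c *: x0).
  rewrite vE; apply: conePD; first exact: sub.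
  by apply: contraNneq v0 => c0; rewrite vE c0 scale0r.
have fixc c : Phi (rho ++ sh) *m (x0 + c *: (v - x0)) = x0 + c *: (v - x0).
  by rewrite mulmxDr -scalemxAr mulmxBr fx0 fv.
have nz c : x0 + c *: (v - x0) != 0.
  apply/negP => /eqP h; have [c0|c0] := eqVneq c 0.
    by move: h; rewrite c0 scale0r addr0 => /eqP; rewrite (negPf x00).
  apply: ndep; exists (1 - c^-1).
  have h' : c^-1 *: x0 + (v - x0) = 0.
    by apply: (scalerI c0); rewrite scalerDr scalerA mulfV // scale1r h scaler0.
  have -> : v = (c^-1 *: x0 + (v - x0)) + (x0 - c^-1 *: x0).
    by apply/matrixP => i j; rewrite !mxE; ring.
  by rewrite h' add0r scalerBl scale1r.
have mut : mutual Fhom Om x0 v.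
  have := @locally_mutual_line R m n Fhom Om x0 (v - x0) _ 1.
  rewrite scale1r [x0 + _]addrC subrK; apply => c.
  apply: (@hom_locally_mutual R n m A B Om rho sh [::]) => //.
  by rewrite cats0 run_hom.
apply: sub; apply: (control_set_sub (Fhom_flow A B) cRD RDx0 _ _ mut).
  apply: (@mutual_ctrl_pre R m n Fhom Om (Fhom_flow A B) _ x0 (rho ++ sh)).
  - by case: (rho) => //; case: (sh) shN.
  - exact: admissible_cat.
  - by rewrite run_hom.
  - by move=> _ [s [_ ->]]; rewrite run_hom /=; apply: Phi_neq0.
by split; apply: orbit_refl.
Qed.

Lemma gel_fixed_point s : 1%:M - Phi s \in unitmx -> exists y : 'cV[R]_n,
  gel s *m col_mx y 1 = col_mx y 1.
Proof.
move=> us; have [b E] := gel_block A B C d s.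
exists (invmx (1%:M - Phi s) *m b).
rewrite E mul_block_col mul0mx add0r mulmx1 mul1mx; congr col_mx.
set y := invmx _ *m b.
have : (1%:M - Phi s) *m y = b by rewrite mulKVmx.
by rewrite mulmxBl mul1mx => <-; rewrite addrC subrK.
Qed.

Lemma gel_col1_run s (y : 'cV[R]_n) :
  gel s *m col_mx y 1 = col_mx y 1 <-> run Faff s y = y.
Proof.
rewrite -run_aff; split=> [/eq_col_mx[]//|->//].
Qed.

(* The durations of [s] are switched on while those of [rho] and [sh] shrink:
   at [t = 1] the homogeneous part has no eigenvalue 1, so by analyticity the
   same holds for arbitrarily small [t > 0]. *)
Lemma perturbed_fixed_points s rho sa sh :
  admissible Om s -> admissible Om rho -> admissible Om sa -> admissible Om sh ->
  1%:M - Phi sa *m Phi s \in unitmx ->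
  forall e, 0 < e -> exists pre post (y : 'cV[R]_n),
    [/\ admissible Om pre, admissible Om post,
        run Faff (pre ++ sa ++ post) y = y &
        n1 (gel (pre ++ sa ++ post) - gel (rho ++ sa ++ sh)) < e].
Proof.
move=> ads adr ada adh us e e0.
(* [sa] keeps its durations, so every [wd t] contains an unchanged full word. *)
pose wd (t : R) := (scale_word t s ++ scale_word (1 - t) rho) ++ sa ++ scale_word (1 - t) sh.
have glE k (M : 'cV[R]_m -> 'M[R]_k) t : gl M (wd t) =
   gl M (scale_word (1 + (-1) * t) sh) *m gl M sa *m
   (gl M (scale_word (1 + (-1) * t) rho) *m gl M (scale_word (0 + 1 * t) s)).
  by rewrite /wd !gl_cat mulN1r add0r mul1r.
have ep k (M : 'cV[R]_m -> 'M[R]_k) : exppoly_mx (fun t => gl M (wd t)).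
  have := exppoly_mxM
    (exppoly_mxM (exppoly_scale_word M 1 (-1) sh) (exppoly_mx_cst (gl M sa)))
    (exppoly_mxM (exppoly_scale_word M 1 (-1) rho) (exppoly_scale_word M 0 1 s)).
  by congr exppoly_mx; apply/funext => t; rewrite glE.
have epq : exppoly (fun t => \det (1%:M - gl Au (wd t))).
  by apply: exppoly_det; apply: exppoly_mxB (ep _ _); apply: exppoly_mx_cst.
have q1 : \det (1%:M - gl Au (wd 1)) != 0.
  have e1 : 1 + -1 * 1 = 0 :> R by ring.
  have e2 : 0 + 1 * 1 = 1 :> R by ring.
  rewrite glE e1 e2 !gl_scale_word0 mul1mx mul1mx scale_word1.
  by rewrite -unitfE -unitmxE.
have wd0 : gl Mhat (wd 0) = gel (rho ++ sa ++ sh).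
  have e1 : 1 + -1 * 0 = 1 :> R by ring.
  have e2 : 0 + 1 * 0 = 0 :> R by ring.
  by rewrite glE e1 e2 gl_scale_word0 mulmx1 !scale_word1 !gel_cat.
have [r r0 hr] := exppoly_mx_near (ep _ Mhat) e0.
(* The cap at 1 keeps the durations scaled by [1 - t] positive. *)
pose r' := Num.min r 1; have r'0 : 0 < r' by rewrite lt_min r0 ltr01.
have [t /andP[t0 tr] qt] : exists2 t, 0 < t < r' & \det (1%:M - gl Au (wd t)) != 0.
  apply: contrapT => no; move/negP: q1; apply; apply/eqP.
  apply: (exppoly_identity epq r'0) => t tr; apply/eqP/negPn/negP => qt.
  by apply: no; exists t.
move: tr; rewrite lt_min => /andP[tr t1].
have t1' : 0 < 1 - t by rewrite subr_gt0.
have [|y hy] := @gel_fixed_point (wd t).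
  by rewrite unitmxE unitfE.
exists (scale_word t s ++ scale_word (1 - t) rho), (scale_word (1 - t) sh), y; split.
- by apply: admissible_cat; apply: scale_word_admissible.
- exact: scale_word_admissible.
- exact/gel_col1_run.
- by rewrite -wd0; apply: hr; rewrite gtr0_norm.
Qed.

Lemma limit_fixed_point N (G : 'M[R]_N) (u : nat -> 'cV[R]_N) (v : 'cV[R]_N) :
  (forall k, n1 (u k) = 1) ->
  (forall k, exists2 G' : 'M[R]_N, G' *m u k = u k & n1 (G' - G) < k.+1%:R^-1) ->
  (forall e (K : nat), 0 < e -> exists2 k, (K <= k)%N & n1 (u k - v) < e) ->
  n1 v = 1 /\ G *m v = v.
Proof.
move=> u1 hG hv; split.
  apply/eqP; rewrite -subr_eq0 -normr_le0; apply/ler_addgt0Pr => e e0; rewrite add0r.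
  have [k _ hk] := hv e 0%N e0; have := u1 k.
  have := n1D (u k - v) v; have := n1D (v - u k) (u k).
  rewrite !subrK [n1 (v - _)]n1_distC ler_norml => h1 h2 h3; apply/andP; split; lra.
apply/subr0_eq/n1_lt_eq0 => e e0.
(* [n1 G] pays for [G *m (v - u k)] and the 1 for [u k - v]; the other half of [e] goes to
   [G - G']. *)
have [r r0 hr] := @small_mul R (n1 G + 1) (e / 2)
  ltac:(by rewrite addr_ge0 ?n1_ge0) ltac:(lra).
pose K := Num.truncn (2 / e).
have [k Kk hk] := hv r K r0.
have [G' G'u hG'] := hG k.
have kE : k.+1%:R^-1 <= e / 2.
  rewrite -[e / 2]invrK lef_pV2 ?posrE ?invr_gt0 ?divr_gt0 // invf_div.
  apply: ltW; apply: lt_le_trans (truncnS_gt _) _; rewrite ler_nat ltnS; exact: Kk.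
have -> : G *m v - v = G *m (v - u k) + (G - G') *m u k + (u k - v).
  rewrite mulmxBr mulmxBl G'u; set a := G *m v; set b := G *m u k.
  by rewrite [a - b + _]addrA !subrK addrA subrK.
apply: le_trans (n1D _ _) _; apply: le_trans (lerD (n1D _ _) (lexx _)) _.
have := n1M G (v - u k); have := n1M (G - G') (u k).
rewrite u1 mulr1 [n1 (v - _)]n1_distC [n1 (G - _)]n1_distC.
have := lt_le_trans hG' kE; have := hr _ (ltW hk); rewrite mulrDl mul1r.
by move: (n1 G * _) => *; lra.
Qed.

End ControlSetsAtInfinity.

Theorem theorem6p4 (R : realType) (n m : nat)
  (A : 'M[R]_n) (B : 'I_m -> 'M[R]_n) (C : 'M[R]_(n, m)) (d : 'cV[R]_n)
  (Om : set 'cV[R]_m) :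
  (exists M : R, forall w, Om w -> mxnorm w <= M) ->
  Om 0 ->
  ARC_aff A B C d Om ->
  ARC_hom A B Om ->
  (exists s : seq ('cV[R]_m * R),
     [/\ s != [::], admissible Om s,
         in_int_S A B C d Om (gel A B C d s) &
         ~~ eigenvalue (Phi A B s) 1]) ->
  finite_set [set D | control_set (Faff A B C d) Om setT D /\ has_interior D] ->
  forall RD : set 'cV[R]_n,
    control_set (Fhom A B) Om [set x | x != 0] RD -> has_interior RD ->
  forall PD : set 'cV[R]_n,
    control_setP (Fhom A B) Om PD -> RD `<=` PD ->
  exists D : set 'cV[R]_n,
    [/\ control_set (Faff A B C d) Om setT D, has_interior D &
        exists x, PD x /\ boundaryP (embedP D) (col_mx x 0)].
Proof.
move=> bnd Om0 arca arch [s [_ ads _ eig]] fin RD cRD iRD PD [[conePD _ _ _] _] sub.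
have us : 1%:M - Phi A B s \in unitmx.
  rewrite -opprB unitmxE -scaleN1r detZ unitrM unitrX ?unitrN1 //= -unitmxE.
  by move: eig; rewrite /eigenvalue negbK /eigenspace kermx_eq0 row_free_unit.
have [x0 [rho [sa [sh [RDx0 x00 [adr ada adh saN shN] [fsa fsh] [fx0 us']]]]]] :=
  hom_loop C d bnd Om0 arch us cRD iRD.
set loop := rho ++ sa ++ sh in fx0.
have adl : admissible Om loop by do 2 apply: admissible_cat => //.
have loopN : loop != [::] by rewrite /loop; case: (rho) => //; case: (sa) saN.
have lm pre post y : admissible Om pre -> admissible Om post ->
    run (Faff A B C d) (pre ++ sa ++ post) y = y -> locally_mutual (Faff A B C d) Om y.
  by move=> a1 a2; apply: (aff_locally_mutual arca a1 ada a2 fsa).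
have [[y hy]|nofix] := pselect (exists y : 'cV[R]_n,
    gel A B C d loop *m col_mx y 1 = col_mx y 1).
  have fixc c : run (Faff A B C d) loop (y + c *: x0) = y + c *: x0.
    apply/gel_col1_run.
    have -> : col_mx (y + c *: x0) (1 : 'cV[R]_1) = col_mx y 1 + c *: col_mx x0 0.
      by rewrite scale_col_mx add_col_mx scaler0 addr0.
    by rewrite mulmxDr hy -scalemxAr gel_col0 fx0.
  have [D [cD iD mD]] : exists D, [/\ control_set (Faff A B C d) Om setT D, has_interior D
      & mutual (Faff A B C d) Om y `<=` D].
    have := fixc 0; rewrite scale0r addr0 => fy.
    exact: (aff_control_set loopN adl fy (lm rho sh y adr adh fy)).
  exists D; split=> //; exists x0; split; first exact: sub.
  apply: boundary_at_infinity => // e e0.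
  have [r r0 hr] := @small_mul R (n1 (col_mx y (1 : 'cV[R]_1))) (e / 2) (n1_ge0 _) ltac:(lra).
  (* Far out on the line of fixed points: scaled by [r], the representative differs from [(x0, 0)]
     exactly by [r] times [(y, 1)]. *)
  exists (y + r^-1 *: x0), r; split; last 1 first.
  - have -> : col_mx x0 0 - r *: col_mx (y + r^-1 *: x0) (1 : 'cV[R]_1) = - (r *: col_mx y 1).
      rewrite !scale_col_mx !opp_col_mx add_col_mx scalerDr scalerA mulfV ?gt_eqF //.
      by rewrite scale1r opprD addrCA subrr addr0 add0r.
    by rewrite n1N n1Z gtr0_norm // mulrC; have := hr r (lexx _); lra.
  - apply: mD; apply: locally_mutual_line => c.
    exact: (lm rho sh _ adr adh (fixc c)).
  - by rewrite gt_eqF.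
(* The fixed points [y] may be unbounded; normalising [(y, 1)] to norm 1 selects representatives in
   projective space that stay in a compact set. *)
have seqP (k : nat) : exists uD : 'cV[R]_(n + 1) * set 'cV[R]_n,
    [/\ n1 uD.1 = 1,
        exists2 G : 'M[R]_(n + 1), G *m uD.1 = uD.1 &
          n1 (G - gel A B C d loop) < k.+1%:R^-1,
        control_set (Faff A B C d) Om setT uD.2 /\ has_interior uD.2 &
        exists y c, [/\ uD.2 y, c != 0 & uD.1 = c *: col_mx y (1 : 'cV[R]_1)]].
  have k0 : 0 < k.+1%:R^-1 :> R by rewrite invr_gt0.
  have [pre [post [y [a1 a2 fy hG]]]] :=
    perturbed_fixed_points C d ads adr ada adh us' k0.
  have adw : admissible Om (pre ++ sa ++ post) by do 2 apply: admissible_cat => //.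
  have wN : pre ++ sa ++ post != [::]. by case: (pre) => //; case: (sa) saN.
  have [D [cD iD mD]] := aff_control_set wN adw fy (lm pre post y a1 a2 fy).
  pose v : 'cV[R]_(n + 1) := col_mx y 1.
  have v0 : n1 v != 0.
    apply/negP => /eqP v0; have /n1_le0 : n1 v <= 0 by rewrite v0.
    rewrite /v -col_mx0 => /eq_col_mx[_ /eqP].
    by rewrite (negPf (oner_neq0 _)).
  exists ((n1 v)^-1 *: v, D); split=> //=.
  - by rewrite n1Z ger0_norm ?invr_ge0 ?n1_ge0 // mulVf.
  - exists (gel A B C d (pre ++ sa ++ post)) => //.
    by rewrite -scalemxAr; congr (_ *: _); apply/gel_col1_run.
  - exists y, (n1 v)^-1; split=> //; last by rewrite invr_eq0.
    by apply: mD; split; apply: orbit_refl.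
have [uD huD] := choice seqP.
have [v [D hv]] := @cluster_seq R _ (fun k => (uD k).1) 1 _ (fun k => (uD k).2) _
  (fun k => ltac:(by have [-> _ _ _] := huD k)) fin
  (fun k => ltac:(by have [_ _ h _] := huD k)).
have [v1 Gv] : n1 v = 1 /\ gel A B C d loop *m v = v.
  apply: (@limit_fixed_point R _ _ (fun k => (uD k).1)).
  - by move=> k; have [] := huD k.
  - by move=> k; have [] := huD k.
  - by move=> e K e0; have [k [Kk hk _]] := hv e K e0; exists k.
have vE : v = col_mx (usubmx v) (dsubmx v) by rewrite vsubmxK.
have dv0 : dsubmx v = 0.
  (* A nonzero last coordinate could be rescaled to 1, giving the loop an affine fixed point. *)
  apply/eqP/negPn/negP => dv; apply: nofix.
  pose l := dsubmx v 0 0.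
  have dvE : dsubmx v = l *: (1 : 'cV[R]_1).
    by rewrite /l {1}[dsubmx v]mx11_scalar -scalemx1.
  have l0 : l != 0 by apply: contraNneq dv => l0; rewrite dvE l0 scale0r.
  exists (l^-1 *: usubmx v).
  have -> : col_mx (l^-1 *: usubmx v) (1 : 'cV[R]_1) = l^-1 *: v.
    by rewrite {2}vE dvE scale_col_mx scalerA mulVf // scale1r.
  by rewrite -scalemxAr Gv.
rewrite dv0 in vE.
have uv0 : usubmx v != 0.
  apply/negP => /eqP uv0; move: v1; rewrite vE uv0 n1_col !n1_0 addr0 => /eqP.
  by rewrite eq_sym oner_eq0.
have [k [_ _ Dk]] := hv 1 0%N ltr01.
have [_ _ [cD iD] _] := huD k; rewrite Dk in cD iD.
exists D; split=> //; exists (usubmx v); split.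
  (* For the homogeneous flow the full piece is [sh], so [sa] joins the prefix. *)
  apply: (@hom_fixed_mem R n m A B Om arch RD PD x0 (rho ++ sa) sh) => //.
  - exact: admissible_cat.
  - by rewrite -catA.
  - rewrite -catA; have := Gv; rewrite {1 2}vE gel_col0.
    by move/eq_col_mx => [].
apply: boundary_at_infinity => // e e0.
have [j [_ hj Dj]] := hv e 0%N e0.
have [_ _ _ [y [c [Dy c0 uE]]]] := huD j.
exists y, c; split=> //; first by rewrite -Dj.
by rewrite -uE -vE n1_distC.
Qed.
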